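(* For every integer $k\geq 1$, $$\frac{17}{8}k-4\;\leq\;\mathrm{sr}(3,k)\;\leq\;\frac{17}{8}k+10 .$$
   Context: For a positive integer $n$, $[n]=\{1,\ldots,n\}$. A coloring of $[n]$ is an assignment of a color to each element, with any number of colors allowed. An arithmetic progression of length $m$ (with nonzero common difference) in a colored set is a rainbow $\mathrm{AP}(m)$ if all of its elements have pairwise distinct colors. A sub-$k$-coloring of $[n]$ is a coloring of $[n]$ in which every color appears on at most $k$ integers. The sub-Ramsey number $\mathrm{sr}(m,k)$ is the minimum $n_0$ such that for every $n>n_0$, any sub-$k$-coloring of $[n]$ contains a rainbow $\mathrm{AP}(m)$. *)

(* Defs.v *)
From mathcomp Require Import all_boot all_order all_algebra.

Set Implicit Arguments.
Unset Strict Implicit.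
Unset Printing Implicit Defensive.

(* A coloring of [n] = {1, ..., n} is given by a function c : nat -> nat of     *)
(* which only the values on 1, ..., n matter. As [n] is finite, using natural  *)
(* numbers as colors does not restrict the number of colors.                   *)

Definition sub_coloring (k n : nat) (c : nat -> nat) : Prop :=
  forall color : nat, count (fun x => c x == color) (iota 1 n) <= k.

(* A progression of nonzero difference is, up to reversal, one of positive     *)
(* difference.                                                                 *)
Definition has_rainbow_AP (m n : nat) (c : nat -> nat) : Prop :=
  exists a d : nat,
    [/\ 0 < d,
        forall i, i < m -> 1 <= a + i * d <= n
      & forall i j, i < m -> j < m -> i != j -> c (a + i * d) != c (a + j * d)].

Definition rainbow_AP_above (m k n0 : nat) : Prop :=
  forall n, n0 < n ->
  forall c, sub_coloring k n c -> has_rainbow_AP m n c.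

(* sr(m, k) = s; the relational form makes the existence of the minimum part   *)
(* of what has to be established.                                              *)
Definition is_sub_ramsey (m k s : nat) : Prop :=
  rainbow_AP_above m k s /\ forall n0, rainbow_AP_above m k n0 -> s <= n0.

Lemma is_sub_ramsey_uniq m k s t :
  is_sub_ramsey m k s -> is_sub_ramsey m k t -> s = t.
Proof.
by move=> [Hs mins] [Ht mint]; apply/eqP; rewrite eqn_leq mins // mint.
Qed.

(* Main.v *)
From Stdlib Require Import ZArith Lia Classical.
Require Import Defs.
From mathcomp Require Import all_boot all_order all_algebra.
From mathcomp Require Import zify lra.
Import Order.TTheory GRing.Theory Num.Theory.

(** Both bounds come from the coloring of the integers by their Legendre symbol
    modulo 17. In a progression of length three exactly one of whose terms is
    divisible by 17, the other two are congruent to [x] and [2x], or to [x] and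
    [-x]. Since -1 and 2 are squares modulo 17, they have the same color, so
    there is no rainbow progression. The two frequent colors have density 8/17,
    which gives the lower bound [legendre17_sub_coloring].

    For the upper bound let [n] places be colored without rainbow progressions,
    each color on at most [k] of them, where [17 k + 80 < 8 n]. First, some color
    [D] is dominant: two neighboring places of different colors always include
    it ([dominant_color]). Second, only one other color, [X], has neighboring
    places ([no_pairs_of_two_colors]); it exists as [D] covers less than half of
    the places. All other colors are merged into one, [Y]; this creates no
    rainbow progressions, and each [Y] is isolated between letters [D]. Since [D]
    and [X] cover less than 16/17 of the places, it remains to show that the
    letters [Y] have density at most 1/17, up to a constant ([no_balanced_word]).

    The main tool is reflection. Two neighboring letters [X], a pair, are
    reflected over a [Y] to a pair again ([pair_reflect]). Hence each gap between
    consecutive letters [Y] that has pairs on both sides contains a pair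
    ([gap_has_pair]). On the other hand, inside a gap of length [m] doubling
    modulo [m] preserves the colors, which forces letters [D], starting from the
    neighbors of its ends. For [m] up to 16 they leave room for a pair only if
    [m = 15] ([gap_with_pair]). If [m = 15] occurs, the whole word has [D] at
    all places prime to 15, counted from the gap, and [D] is too frequent
    ([gap15_dense]). So the gaps between the first and the last pair have length
    at least 17.

    The letters [Y] before the first pair all lie in the first half of that part,
    since otherwise the pair could be reflected there. It is enough that, away
    from the border, their gaps are longer than eight ([Yfree_upto8]). Gaps of
    length 2 would give an earlier pair at once ([Yfree_2]). Gaps of length 3, 5
    and 7 are excluded by moving the pair into the gap by repeated
    halving ([window_X_apart]), gaps of length 4 and 8 by letters [X] that descend
    along a lattice into the gap ([even_gap_lattice]). Gaps of length 6 are
    possible as such, but they make [D] too frequent ([gap6_dense]). The letters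
    after the last pair are treated by reversing the word. *)

Local Open Scope Z_scope.

(** * Words without rainbow progressions *)

Definition rainbow_free {C : Type} (f : Z -> C) (n : Z) : Prop :=
  forall a b c, 0 <= a < n -> 0 <= b < n -> 0 <= c < n -> a + c = 2 * b ->
  ~ (f a <> f b /\ f b <> f c /\ f a <> f c).

(** Some order of the three places is a progression; the forbidden pattern does
    not depend on the order. *)
Definition in_ap (a b c : Z) : Prop :=
  a + c = 2 * b \/ a + b = 2 * c \/ b + c = 2 * a.

Lemma third_color {C : Type} {f : Z -> C} {n a b : Z} {u v : C} (c : Z) :
  rainbow_free f n -> f a = u -> f b = v -> u <> v ->
  0 <= a < n -> 0 <= b < n -> 0 <= c < n -> in_ap a b c ->
  f c = u \/ f c = v.
Proof.
intros H <- <- Huv Ha Hb Hc Hap.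
destruct (classic (f c = f a)) as [E | Ea]; [now left |].
destruct (classic (f c = f b)) as [E | Eb]; [now right | exfalso].
destruct Hap as [E | [E | E]].
- apply (H a b c Ha Hb Hc E); repeat split; congruence.
- apply (H a c b Ha Hc Hb E); repeat split; congruence.
- apply (H b a c Hb Ha Hc E); repeat split; congruence.
Qed.

Lemma rainbow_false {C : Type} {f : Z -> C} {n a b c : Z} {u v w : C} :
  rainbow_free f n -> f a = u -> f b = v -> f c = w ->
  u <> v -> v <> w -> u <> w ->
  0 <= a < n -> 0 <= b < n -> 0 <= c < n -> in_ap a b c -> False.
Proof.
intros H Ea Eb Ec Huv Hvw Huw Ha Hb Hc Hap.
destruct (third_color c H Ea Eb Huv Ha Hb Hc Hap); congruence.
Qed.

Ltac ap_side := first [ discriminate | congruence | unfold in_ap in *; lia ].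

Tactic Notation "third" constr(H) constr(Ea) constr(Eb) constr(c)
    "as" simple_intropattern(p) :=
  let K := fresh "K" in
  let N := fresh "N" in
  assert (K := third_color c H Ea Eb);
  match type of K with ?A -> _ => assert (N : A) end;
  [ try solve [ discriminate | congruence ]
  | specialize (K N ltac:(lia) ltac:(lia) ltac:(lia) ltac:(unfold in_ap; lia));
    clear N; destruct K as p ].

Ltac rainbow H Ea Eb Ec :=
  exfalso; apply (rainbow_false H Ea Eb Ec); ap_side.

(** * Counting *)

Fixpoint cnt (p : Z -> bool) (a : Z) (l : nat) : Z :=
  match l with
  | O => 0
  | S l => (if p a then 1 else 0) + cnt p (a + 1) l
  end.

Lemma cnt_bounds p a l : 0 <= cnt p a l <= Z.of_nat l.
Proof.
revert a; induction l as [|l IH]; intros a; cbn -[Z.of_nat]; [lia |].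
specialize (IH (a + 1)); destruct (p a); lia.
Qed.

Lemma cnt_cat p a l1 l2 :
  cnt p a (l1 + l2)%nat = cnt p a l1 + cnt p (a + Z.of_nat l1) l2.
Proof.
revert a; induction l1 as [|l1 IH]; intros a.
  cbn; f_equal; lia.
change (S l1 + l2)%nat with (S (l1 + l2)); cbn -[Z.of_nat].
rewrite IH; replace (a + Z.of_nat (S l1)) with (a + 1 + Z.of_nat l1) by lia.
lia.
Qed.

(** Two windows, so that this serves for shifts as well. *)
Lemma cnt_le p q a b l :
  (forall i, 0 <= i < Z.of_nat l -> p (a + i) = true -> q (b + i) = true) ->
  cnt p a l <= cnt q b l.
Proof.
revert a b; induction l as [|l IH]; intros a b H; cbn -[Z.of_nat]; [lia |].
assert (H0 := H 0 ltac:(lia)); rewrite !Z.add_0_r in H0.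
assert (IH1 : cnt p (a + 1) l <= cnt q (b + 1) l).
  apply IH; intros i Hi Hp.
  replace (b + 1 + i) with (b + (1 + i)) by lia.
  apply H; [lia |]; now replace (a + (1 + i)) with (a + 1 + i) by lia.
destruct (p a), (q b); try lia; now discriminate H0.
Qed.

Lemma cnt_ext p q a b l :
  (forall i, 0 <= i < Z.of_nat l -> p (a + i) = q (b + i)) ->
  cnt p a l = cnt q b l.
Proof.
intros H; apply Z.le_antisymm; apply cnt_le; intros i Hi; now rewrite H.
Qed.

Lemma cnt_none p a l :
  (forall i, a <= i < a + Z.of_nat l -> p i = false) -> cnt p a l = 0.
Proof.
revert a; induction l as [|l IH]; intros a H; cbn -[Z.of_nat]; [reflexivity |].
rewrite (H a ltac:(lia)) IH; [reflexivity |].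
intros i Hi; apply H; lia.
Qed.

Lemma cnt_negb p a l : cnt p a l + cnt (fun x => negb (p x)) a l = Z.of_nat l.
Proof.
revert a; induction l as [|l IH]; intros a; cbn -[Z.of_nat]; [lia |].
specialize (IH (a + 1)); destruct (p a); cbn [negb]; lia.
Qed.

Lemma cnt_cover p q r a l :
  (forall i, 0 <= i < Z.of_nat l ->
     r (a + i) = true -> p (a + i) = true \/ q (a + i) = true) ->
  cnt r a l <= cnt p a l + cnt q a l.
Proof.
revert a; induction l as [|l IH]; intros a H; cbn -[Z.of_nat]; [lia |].
assert (H0 := H 0 ltac:(lia)); rewrite !Z.add_0_r in H0.
assert (IH1 : cnt r (a + 1) l <= cnt p (a + 1) l + cnt q (a + 1) l).
  apply IH; intros i Hi.
  replace (a + 1 + i) with (a + (1 + i)) by lia; apply H; lia.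
destruct (p a), (q a), (r a); lia.
Qed.

Lemma cnt_sub p a b l m :
  a <= b -> b + Z.of_nat m <= a + Z.of_nat l -> cnt p b m <= cnt p a l.
Proof.
intros Hab Hl.
replace l with ((Z.to_nat (b - a) + m) +
                (l - (Z.to_nat (b - a) + m)))%nat by lia.
rewrite !cnt_cat.
replace (a + Z.of_nat (Z.to_nat (b - a))) with b by lia.
assert (H1 := cnt_bounds p a (Z.to_nat (b - a))).
match goal with |- _ <= _ + cnt p ?x ?y => assert (H2 := cnt_bounds p x y) end.
lia.
Qed.

Lemma cnt_rev p n : cnt (fun x => p (Z.of_nat n - 1 - x)) 0 n = cnt p 0 n.
Proof.
assert (H : forall l a, cnt (fun x => p (a + Z.of_nat l - 1 - x)) 0 l = cnt p a l).
  induction l as [|l IH]; intros a; [reflexivity |].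
  replace (S l) with (l + 1)%nat at 2 by lia.
  rewrite cnt_cat; cbn -[Z.of_nat].
  rewrite <- (IH a).
  replace (a + Z.of_nat (S l) - 1 - 0) with (a + Z.of_nat l) by lia.
  rewrite (cnt_ext (fun x => p (a + Z.of_nat (S l) - 1 - x))
                   (fun x => p (a + Z.of_nat l - 1 - x)) (0 + 1) 0).
    lia.
  intros i _; f_equal; lia.
rewrite <- (H n 0); apply cnt_ext; intros i _; f_equal; lia.
Qed.

Lemma cnt_parity p a l :
  cnt p a (2 * l)%nat =
  cnt (fun i => p (a + 2 * i)) 0 l + cnt (fun i => p (a + 1 + 2 * i)) 0 l.
Proof.
revert a; induction l as [|l IH]; intros a; [reflexivity |].
replace (2 * S l)%nat with (S (S (2 * l))) by lia; cbn -[Z.of_nat Nat.mul Z.mul].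
rewrite IH.
replace (a + 2 * 0) with a by lia; replace (a + 1 + 2 * 0) with (a + 1) by lia.
rewrite (cnt_ext (fun i => p (a + 2 * i)) (fun i => p (a + 1 + 1 + 2 * i)) (0 + 1) 0).
  rewrite (cnt_ext (fun i => p (a + 1 + 2 * i))
                   (fun i => p (a + 1 + 1 + 1 + 2 * i)) (0 + 1) 0).
    lia.
  intros i _; f_equal; lia.
intros i _; f_equal; lia.
Qed.

Lemma cnt_le1 p a l :
  (forall x y, a <= x -> x < y -> y < a + Z.of_nat l -> p x = true -> p y = true ->
     False) ->
  cnt p a l <= 1.
Proof.
revert a; induction l as [|l IH]; intros a H; cbn -[Z.of_nat]; [lia |].
destruct (p a) eqn:Ea.
  rewrite cnt_none; [lia |].
  intros i Hi; destruct (p i) eqn:Ei; [exfalso | reflexivity].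
  apply (H a i); auto; lia.
assert (cnt p (a + 1) l <= 1); [apply IH | lia].
intros x y Hx Hxy Hy; apply H; lia.
Qed.

Lemma cnt_spaced g p a l :
  0 < g ->
  (forall x y, a <= x -> x < y -> y < a + Z.of_nat l -> y - x < g ->
     p x = true -> p y = true -> False) ->
  g * cnt p a l <= Z.of_nat l + g - 1.
Proof.
intros Hg; revert a.
induction l as [l IH] using (well_founded_induction Wf_nat.lt_wf); intros a H.
destruct (Z_lt_le_dec (Z.of_nat l) g) as [Hl | Hl].
  destruct l as [|l]; [cbn; lia |].
  assert (cnt p a (S l) <= 1); [| nia].
  apply cnt_le1; intros x y Hx Hxy Hy; apply H; lia.
replace l with (Z.to_nat g + (l - Z.to_nat g))%nat by lia.
rewrite cnt_cat.
assert (H1 : cnt p a (Z.to_nat g) <= 1).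
  apply cnt_le1; intros x y Hx Hxy Hy; apply H; lia.
assert (H2 := IH (l - Z.to_nat g)%nat ltac:(lia) (a + Z.of_nat (Z.to_nat g))).
assert (H3 := H2 ltac:(intros x y Hx Hxy Hy; apply H; lia)).
nia.
Qed.

(** * The dominant color *)

Definition undominated {C : Type} (f : Z -> C) (i j : Z) : Prop :=
  forall P, exists t, i <= t < j /\ f t <> f (t + 1) /\ f t <> P /\ f (t + 1) <> P.

(** The shortest stretch without a dominant color has this form: its first color
    change avoids [P], its last one avoids [Q], and all the others are between
    [P] and [Q]. *)
Definition bridge {C : Type} (f : Z -> C) (s e : Z) (P Q : C) : Prop :=
  s < e /\ f s <> P /\ f s <> Q /\ f e <> P /\ f e <> Q /\
  f (s + 1) = Q /\ f (e - 1) = P /\ P <> Q /\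
  forall x, s < x < e -> f x = P \/ f x = Q.

(** Without its first color change a shortest such stretch has a dominant color
    [P], without its last one a dominant color [Q]. All changes but these two
    contain both. *)
Lemma undominated_bridge {C : Type} (f : Z -> C) i j :
  undominated f i j -> exists s e P Q, i <= s /\ e <= j /\ bridge f s e P Q.
Proof.
remember (Z.to_nat (j - i)) as l eqn:El; revert i j El.
induction l as [l IH] using (well_founded_induction Wf_nat.lt_wf).
intros i j -> Hb.
assert (Hij : i < j) by (destruct (Hb (f i)) as [t Ht]; lia).
destruct (classic (undominated f (i + 1) j)) as [H1 | H1].
  destruct (IH (Z.to_nat (j - (i + 1))) ltac:(lia) (i + 1) j erefl H1)
    as (s & e & P & Q & Hs & He & H); exists s, e, P, Q.
  repeat split; try apply H; lia.
destruct (classic (undominated f i (j - 1))) as [H2 | H2].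
  destruct (IH (Z.to_nat (j - 1 - i)) ltac:(lia) i (j - 1) erefl H2)
    as (s & e & P & Q & Hs & He & H); exists s, e, P, Q.
  repeat split; try apply H; lia.
assert (H1' : exists P, forall t, i + 1 <= t < j -> f t <> f (t + 1) ->
                f t = P \/ f (t + 1) = P).
  apply NNPP; intros Hn; apply H1; intros P; apply NNPP; intros Ht; apply Hn.
  exists P; intros t Hr Hne; apply NNPP; intros Hor; apply Ht; exists t; tauto.
assert (H2' : exists Q, forall t, i <= t < j - 1 -> f t <> f (t + 1) ->
                f t = Q \/ f (t + 1) = Q).
  apply NNPP; intros Hn; apply H2; intros P; apply NNPP; intros Ht; apply Hn.
  exists P; intros t Hr Hne; apply NNPP; intros Hor; apply Ht; exists t; tauto.
clear IH H1 H2; destruct H1' as [P HP]; destruct H2' as [Q HQ].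
destruct (Hb P) as (t1 & Ht1 & Hne1 & Hc1 & Hd1).
assert (E1 : t1 = i).
  destruct (Z.eq_dec t1 i); [auto |].
  destruct (HP t1 ltac:(lia) Hne1); contradiction.
subst t1.
destruct (Hb Q) as (t2 & Ht2 & Hne2 & Hc2 & Hd2).
assert (E2 : t2 = j - 1).
  destruct (Z.eq_dec t2 (j - 1)); [auto |].
  destruct (HQ t2 ltac:(lia) Hne2); contradiction.
subst t2; replace (j - 1 + 1) with j in * by lia.
assert (Hij2 : i < j - 1).
  destruct (Z_lt_le_dec i (j - 1)) as [|Hle]; [auto | exfalso].
  destruct (Hb (f i)) as (t & Ht & _ & Hc & _); apply Hc; f_equal; lia.
assert (Hmid : forall d, (forall z, i < z <= i + 1 + Z.of_nat d -> z < j ->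
                            f z = f (i + 1)) \/
                 ((f (i + 1) = P \/ f (i + 1) = Q) /\
                  forall z, i < z <= i + 1 + Z.of_nat d -> z < j ->
                    f z = P \/ f z = Q)).
  induction d as [|d IHd].
    left; intros z Hz _; f_equal; lia.
  set (y := i + 1 + Z.of_nat d) in *.
  replace (i + 1 + Z.of_nat (S d)) with (y + 1) by lia.
  destruct (Z_lt_le_dec (y + 1) j) as [Hy | Hy]; cycle 1.
    destruct IHd as [IHd | [IH0 IHd]]; [left | right; split; [exact IH0 | idtac]];
      intros z Hz Hzj; apply IHd; lia.
  destruct (classic (f y = f (y + 1))) as [E | E].
    destruct IHd as [IHd | [IH0 IHd]]; [left | right; split; [exact IH0 | idtac]];
      intros z Hz Hzj; (destruct (Z.eq_dec z (y + 1)) as [-> | Hn];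
        [rewrite <- E; apply IHd; lia | apply IHd; lia]).
  assert (EP := HP y ltac:(lia) E); assert (EQ := HQ y ltac:(lia) E).
  assert (HPQ : P <> Q).
    intros <-; destruct (HQ i ltac:(lia) Hne1); contradiction.
  assert (Ey : (f y = P \/ f y = Q) /\ (f (y + 1) = P \/ f (y + 1) = Q)).
    destruct EP, EQ; try congruence; split; auto.
  right; destruct IHd as [IHd | [IH0 IHd]]; split; auto.
  - rewrite <- (IHd y); [tauto | lia | lia].
  - intros z Hz Hzj; destruct (Z.eq_dec z (y + 1)) as [-> | Hn]; [tauto |].
    rewrite (IHd z ltac:(lia) ltac:(lia)) -(IHd y ltac:(lia) ltac:(lia)); tauto.
  - intros z Hz Hzj; destruct (Z.eq_dec z (y + 1)) as [-> | Hn]; [tauto |].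
    apply IHd; lia.
destruct (Hmid (Z.to_nat (j - i))) as [Hc | [H0 Hm]].
  exfalso; destruct (Hb (f (i + 1))) as (t & Ht & Hne & Hct & Hdt).
  destruct (Z.eq_dec t i) as [-> | Hti]; [contradiction |].
  apply Hct, Hc; lia.
assert (H3 := Hm (j - 1) ltac:(lia) ltac:(lia)).
exists i, j, P, Q.
assert (f (i + 1) = Q) by tauto; assert (f (j - 1) = P) by tauto.
repeat split; try lia; try tauto; try congruence.
intros x Hx; apply Hm; lia.
Qed.

(** Doubling the distance from the outer end [s]: its color differs from the two
    inner ones, so these have to agree. *)
Lemma bridge_double {C : Type} {f : Z -> C} {n s e P Q} :
  rainbow_free f n -> bridge f s e P Q -> 0 <= s -> e < n ->
  forall u w, s < u < e -> s < w < e -> in_ap s u w -> f u = f w.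
Proof.
intros H (Hse & A1 & A2 & _ & _ & _ & _ & HPQ & Hm) Hs He u w Hu Hw Hap.
destruct (Hm u Hu) as [Eu | Eu], (Hm w Hw) as [Ew | Ew]; try congruence.
- rainbow H (erefl (f s)) Eu Ew.
- rainbow H (erefl (f s)) Eu Ew.
Qed.

(** Doubling from both ends makes the colors of the inside nearly periodic. A
    place outside then is the end of a progression whose other two terms are an
    inner place and the far end of the bridge. Depending on the parity of the
    length, this is impossible for the first or for the second place outside. *)
Lemma bridge_left {C : Type} {f : Z -> C} {n s e P Q} :
  rainbow_free f n -> bridge f s e P Q -> 2 <= s -> e < n -> False.
Proof.
intros H B Hs He.
assert (Hd := bridge_double H B ltac:(lia) He).
destruct B as (Hse & A1 & A2 & A3 & A4 & EQ & EP & HPQ & Hm).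
assert (Hp : s + 3 <= e).
  destruct (Z.eq_dec e (s + 1)) as [-> | ?]; [congruence |].
  destruct (Z.eq_dec e (s + 2)) as [-> | ?]; [| lia].
  replace (s + 2 - 1) with (s + 1) in EP by lia; congruence.
assert (Hm2 : forall x, s < x < e -> f x <> f s).
  intros x Hx E; destruct (Hm x Hx); congruence.
destruct (Z.Even_or_Odd (e - s)) as [[h Hh] | [h Hh]].
- assert (Ee : f e = f s).
    apply NNPP; intros Hne.
    destruct (Hm (s + h) ltac:(lia)) as [E | E];
      rainbow H E (erefl (f s)) (erefl (f e)).
  assert (E2 : f (e - 2) = P).
    third H (erefl (f e)) EP (e - 2) as [E | E]; [| exact E].
    exfalso; apply (Hm2 (e - 2)); [lia | congruence].
  assert (Eh : f (s + (h - 1)) = P).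
    rewrite <- E2; apply Hd; unfold in_ap; lia.
  assert (F2 : f (s + 2) = Q).
    rewrite <- EQ; symmetry; apply Hd; unfold in_ap; lia.
  assert (Es : f (s - 2) = f s).
    third H (erefl (f e)) Eh (s - 2) as [E | E]; [congruence |].
    third H (erefl (f s)) F2 (s - 2) as [E' | E']; congruence.
  assert (Hc : forall d, s + 1 + Z.of_nat d <= s + (h - 1) ->
                 f (s + 1 + Z.of_nat d) = Q).
    induction d as [|d IH]; intros Hdh.
      rewrite <- EQ; f_equal; lia.
    rewrite <- IH by lia.
    set (x := 1 + Z.of_nat d) in *.
    replace (s + 1 + Z.of_nat (S d)) with (s + (x + 1)) by lia.
    replace (s + 1 + Z.of_nat d) with (s + x) by lia.
    rewrite (Hd (s + (x + 1)) (s + (2 * x + 2))); [| lia | lia | unfold in_ap; lia].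
    third H Es (erefl (f (s + x))) (s + (2 * x + 2)) as [E | E].
    + apply not_eq_sym, Hm2; lia.
    + exfalso; apply (Hm2 (s + (2 * x + 2))); [lia | exact E].
    + exact E.
  apply HPQ; rewrite -Eh -(Hc (Z.to_nat (h - 2)) ltac:(lia)); f_equal; lia.
- assert (E1 : f (s - 1) = Q).
    third H (erefl (f s)) EQ (s - 1) as [E | E]; [exfalso | exact E].
    assert (Hc : forall x, 1 <= x -> s + x < e -> f (s + x) = Q).
      intros x; remember (Z.to_nat x) as l eqn:El; revert x El.
      induction l as [l IH] using (well_founded_induction Wf_nat.lt_wf).
      intros x -> Hx1 Hxe.
      destruct (Z.eq_dec x 1) as [-> | Hne]; [exact EQ |].
      destruct (Z.Even_or_Odd x) as [[y Hy] | [y Hy]].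
        rewrite <- (IH (Z.to_nat y) ltac:(lia) y erefl ltac:(lia) ltac:(lia)).
        apply Hd; unfold in_ap; lia.
      assert (Ey := IH (Z.to_nat y) ltac:(lia) y erefl ltac:(lia) ltac:(lia)).
      third H E Ey (s + x) as [F | F]; [exfalso | exact F].
      apply (Hm2 (s + x)); [lia | exact F].
    apply HPQ; rewrite -EP -(Hc (e - 1 - s) ltac:(lia) ltac:(lia)); f_equal; lia.
  assert (Eh : f (s + h) = P).
    rewrite <- EP; apply Hd; unfold in_ap; lia.
  rainbow H E1 Eh (erefl (f e)).
Qed.

Definition flip {C : Type} (n : Z) (f : Z -> C) : Z -> C := fun x => f (n - 1 - x).

Lemma rainbow_free_flip {C : Type} {f : Z -> C} {n} :
  rainbow_free f n -> rainbow_free (flip n f) n.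
Proof.
intros H a b c Ha Hb Hc E; apply (H (n - 1 - a) (n - 1 - b) (n - 1 - c)); lia.
Qed.

Lemma bridge_flip {C : Type} {f : Z -> C} n {s e P Q} :
  bridge f s e P Q -> bridge (flip n f) (n - 1 - e) (n - 1 - s) Q P.
Proof.
intros (Hse & A1 & A2 & A3 & A4 & EQ & EP & HPQ & Hm); unfold bridge, flip.
replace (n - 1 - (n - 1 - e)) with e by lia.
replace (n - 1 - (n - 1 - s)) with s by lia.
replace (n - 1 - (n - 1 - e + 1)) with (e - 1) by lia.
replace (n - 1 - (n - 1 - s - 1)) with (s + 1) by lia.
repeat split; auto; try lia.
intros x Hx; apply or_comm, Hm; lia.
Qed.

(** A bridge leaves at most two places on each side, so that nearly all places
    have only two colors, and one of these is too frequent. *)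
Lemma dominant_color {f : Z -> nat} {n : nat} {k : Z} :
  rainbow_free f (Z.of_nat n) ->
  (forall q, cnt (fun x => f x == q) 0 n <= k) -> 2 * k + 4 < Z.of_nat n ->
  exists P, forall x, 0 <= x -> x + 1 < Z.of_nat n -> f x <> f (x + 1) ->
    f x = P \/ f (x + 1) = P.
Proof.
intros H Hk Hn; apply NNPP; intros Hno.
destruct (undominated_bridge f 0 (Z.of_nat n - 1)) as (s & e & P & Q & Hs & He & B).
  intros P; apply NNPP; intros Ht; apply Hno; exists P; intros x Hx Hx1 Hne.
  apply NNPP; intros Hor; apply Ht; exists x; repeat split; try tauto; lia.
assert (Hs1 : s < 2).
  destruct (Z_lt_le_dec s 2); [auto | exfalso].
  apply (bridge_left H B); lia.
assert (He1 : Z.of_nat n - 1 - e < 2).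
  destruct (Z_lt_le_dec (Z.of_nat n - 1 - e) 2); [auto | exfalso].
  apply (bridge_left (rainbow_free_flip H) (bridge_flip _ B)); lia.
destruct B as (Hse & _ & _ & _ & _ & _ & _ & _ & Hm).
assert (H1 := cnt_sub (fun x => (f x == P) || (f x == Q)) 0 (s + 1) n
                (Z.to_nat (e - s - 1)) ltac:(lia) ltac:(lia)).
assert (H2 := cnt_cover (fun x => f x == P) (fun x => f x == Q)
                (fun x => (f x == P) || (f x == Q)) 0 n
                ltac:(intros i _ Hi; apply Bool.orb_prop; exact Hi)).
assert (H3 := cnt_negb (fun x => (f x == P) || (f x == Q)) (s + 1)
                (Z.to_nat (e - s - 1))).
rewrite (cnt_none (fun x => negb ((f x == P) || (f x == Q)))) in H3.
  assert (H7 := Hk P); assert (H8 := Hk Q); lia.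
intros i Hi; destruct (Hm i ltac:(lia)) as [-> | ->]; now rewrite eqxx ?orbT.
Qed.

Set Implicit Arguments.
Unset Strict Implicit.
Unset Printing Implicit Defensive.

(** * Three-color words *)

(** [D] is the dominant color, [X] the other color that has two neighboring
    places, and [Y] stands for all remaining colors. *)
Inductive color := D | X | Y.

Definition color_eqb (u v : color) : bool :=
  match u, v with D, D | X, X | Y, Y => true | _, _ => false end.

Lemma color_eqbP u v : color_eqb u v = true <-> u = v.
Proof. destruct u, v; split; auto; discriminate. Qed.

Definition adjacent (x y : Z) : Prop := x + 1 = y \/ y + 1 = x.

Record dominated (f : Z -> color) (n : Z) : Prop := {
  dom_free : rainbow_free f n;
  dom_adj : forall x y, 0 <= x < n -> 0 <= y < n -> adjacent x y ->
    f x = X -> f y = Y -> False }.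

Definition swap (u : color) : color := match u with D => D | X => Y | Y => X end.

Lemma swapK u v : swap u = v -> u = swap v.
Proof. destruct u, v; auto; discriminate. Qed.

Lemma dominated_swap {f n} : dominated f n -> dominated (fun x => swap (f x)) n.
Proof.
intros [H A]; split.
- intros a b c Ha Hb Hc E (N1 & N2 & N3); apply (H a b c Ha Hb Hc E).
  repeat split; intros F; rewrite F in N1 N2 N3; auto.
- intros x y Hx Hy Hxy Ex Ey; apply swapK in Ex; apply swapK in Ey.
  apply (A y x); auto; destruct Hxy; [right | left]; auto.
Qed.

Lemma dominated_flip {f n} : dominated f n -> dominated (flip n f) n.
Proof.
intros [H A]; split; [now apply rainbow_free_flip |].
intros x y Hx Hy Hxy; apply A; unfold adjacent in *; lia.
Qed.

Definition pair_at (f : Z -> color) (u : color) (x : Z) : Prop :=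
  f x = u /\ f (x + 1) = u.

(** * Only one color besides the dominant one has pairs *)


(** The minimality used in the proof that pairs [XX] and [YY] exclude each
    other. *)
Definition closest (f : Z -> color) (s t : Z) : Prop :=
  forall x y, s <= x <= t -> s <= y <= t -> Z.abs (x - y) < t - s ->
    pair_at f X x -> pair_at f Y y -> False.

Lemma closest_X_solitary {f n s t} : dominated f n -> closest f s t ->
  0 <= s -> t + 1 < n -> pair_at f Y t ->
  forall x, s + 1 < x < t -> f x = X -> f (x - 1) = D /\ f (x + 1) = D.
Proof.
intros [H A] Hc Hs Ht PY x Hx Ex; split.
- destruct (f (x - 1)) eqn:E; auto; exfalso.
  + apply (Hc (x - 1) t); try lia; auto; split; auto.
    now replace (x - 1 + 1) with x by lia.
  + apply (A x (x - 1)); auto; unfold adjacent; lia.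
- destruct (f (x + 1)) eqn:E; auto; exfalso.
  + apply (Hc x t); try lia; auto; split; auto.
  + apply (A x (x + 1)); auto; unfold adjacent; lia.
Qed.

Lemma closest_Y_solitary {f n s t} : dominated f n -> closest f s t ->
  0 <= s -> t + 1 < n -> pair_at f X s ->
  forall y, s + 1 < y < t -> f y = Y -> f (y - 1) = D /\ f (y + 1) = D.
Proof.
intros [H A] Hc Hs Ht PX y Hy Ey; split.
- destruct (f (y - 1)) eqn:E; auto; exfalso.
  + apply (A (y - 1) y); auto; unfold adjacent; lia.
  + apply (Hc s (y - 1)); try lia; auto; split; auto.
    now replace (y - 1 + 1) with y by lia.
- destruct (f (y + 1)) eqn:E; auto; exfalso.
  + apply (A (y + 1) y); auto; unfold adjacent; lia.
  + apply (Hc s y); try lia; auto; split; auto.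
Qed.

(** The middle of [x] and the pair at [t] is [X] or [Y], and it also is the
    middle of a neighbor of [x], which is [D], and the other letter of that pair.
    Hence it is [Y]. *)
Lemma closest_X_to_Y {f n s t} : dominated f n -> closest f s t ->
  0 <= s -> t + 1 < n -> pair_at f X s -> pair_at f Y t ->
  forall x, s + 1 < x < t -> f x = X ->
  exists y, x + t <= 2 * y <= x + t + 1 /\ s + 1 < y < t /\ f y = Y.
Proof.
intros W Hc Hs Ht PX PY x Hx Ex.
destruct (closest_X_solitary W Hc Hs Ht PY Hx Ex) as [E1 E2].
destruct PY as [T1 T2]; assert (H := dom_free W).
assert (Hxt : x + 1 < t).
  destruct (Z.eq_dec (x + 1) t) as [E | ?]; [rewrite E in E2; congruence | lia].
destruct (Z.Even_or_Odd (t - x)) as [[h Hh] | [h Hh]].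
- exists (x + h); repeat split; try lia.
  third H Ex T1 (x + h) as [E | E]; [| exact E].
  rainbow H E1 E T2.
- exists (x + h + 1); repeat split; try lia.
  third H Ex T2 (x + h + 1) as [E | E]; [| exact E].
  rainbow H E2 E T1.
Qed.

Lemma closest_Y_to_X {f n s t} : dominated f n -> closest f s t ->
  0 <= s -> t + 1 < n -> pair_at f X s -> pair_at f Y t ->
  forall y, s + 1 < y < t -> f y = Y ->
  exists x, y + s <= 2 * x <= y + s + 1 /\ s + 1 < x < t /\ f x = X.
Proof.
intros W Hc Hs Ht PX PY y Hy Ey.
destruct (closest_Y_solitary W Hc Hs Ht PX Hy Ey) as [E1 E2].
destruct PX as [S1 S2]; assert (H := dom_free W).
assert (Hsy : s + 1 < y - 1).
  destruct (Z.eq_dec (y - 1) (s + 1)) as [E | ?]; [rewrite E in E1; congruence | lia].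
destruct (Z.Even_or_Odd (y - s)) as [[h Hh] | [h Hh]].
- exists (s + h); repeat split; try lia.
  third H S1 Ey (s + h) as [E | E]; [exact E |].
  rainbow H S2 E E1.
- exists (s + h + 1); repeat split; try lia.
  third H S2 Ey (s + h + 1) as [E | E]; [exact E |].
  rainbow H S1 E E2.
Qed.

(** Halving towards [t] and back towards [s] brings the two letters nearer to each
    other without making them equal, and they can never become neighbors. *)
Lemma closest_X_unique {f n s t} : dominated f n -> closest f s t ->
  0 <= s -> t + 1 < n -> pair_at f X s -> pair_at f Y t ->
  forall x1 x2, s + 1 < x1 -> x1 < x2 -> x2 < t -> f x1 = X -> f x2 = X -> False.
Proof.
intros W Hc Hs Ht PX PY x1 x2.
remember (Z.to_nat (x2 - x1)) as l eqn:El; revert x1 x2 El.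
induction l as [l IH] using (well_founded_induction Wf_nat.lt_wf).
intros x1 x2 -> H1 H12 H2 E1 E2.
destruct (Z.eq_dec x2 (x1 + 1)) as [-> | Hne].
  destruct (closest_X_solitary (x:=x1) W Hc Hs Ht PY ltac:(lia) E1); congruence.
destruct (closest_X_to_Y (x:=x1) W Hc Hs Ht PX PY ltac:(lia) E1)
  as (y1 & Hy1 & Hr1 & F1).
destruct (closest_X_to_Y (x:=x2) W Hc Hs Ht PX PY ltac:(lia) E2)
  as (y2 & Hy2 & Hr2 & F2).
destruct (Z.eq_dec y2 (y1 + 1)) as [-> | Hney].
  destruct (closest_Y_solitary (y:=y1) W Hc Hs Ht PX ltac:(lia) F1); congruence.
destruct (closest_Y_to_X (y:=y1) W Hc Hs Ht PX PY ltac:(lia) F1)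
  as (z1 & Hz1 & Hq1 & G1).
destruct (closest_Y_to_X (y:=y2) W Hc Hs Ht PX PY ltac:(lia) F2)
  as (z2 & Hz2 & Hq2 & G2).
apply (IH (Z.to_nat (z2 - z1)) ltac:(lia) z1 z2 erefl); auto; lia.
Qed.

(** Halving towards [t] and then towards [s] leads from the middle to a different
    [X]. *)
Lemma closest_middle_not_X {f n s t m} : dominated f n -> closest f s t ->
  0 <= s -> t + 1 < n -> pair_at f X s -> pair_at f Y t ->
  s + 1 < t -> s + t + 1 = 2 * m -> f m = X -> False.
Proof.
intros W Hc Hs Ht PX PY Hst Hm Em.
assert (Hms : s + 1 < m - 1).
  destruct (Z_lt_le_dec (s + 1) (m - 1)) as [? | Hle]; [auto | exfalso].
  destruct (closest_X_solitary (x:=m) W Hc Hs Ht PY ltac:(lia) Em) as [E _].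
  replace (m - 1) with (s + 1) in E by lia.
  destruct PX; congruence.
destruct (closest_X_to_Y (x:=m) W Hc Hs Ht PX PY ltac:(lia) Em)
  as (y & Hy & Hr & F).
destruct (closest_Y_to_X (y:=y) W Hc Hs Ht PX PY ltac:(lia) F)
  as (z & Hz & Hq & G).
apply (closest_X_unique W Hc Hs Ht PX PY (x1:=z) (x2:=m)); auto; lia.
Qed.

(** Take two such pairs at the least distance. If it is even, the middles of
    their letters form a pair that is nearer to one of them. If it is odd, they
    have a single middle, which is [X] or [Y]. *)
Lemma no_pairs_of_two_colors {f n s t} : dominated f n ->
  0 <= s < t -> t + 1 < n -> pair_at f X s -> pair_at f Y t -> False.
Proof.
remember (Z.to_nat (t - s)) as l eqn:El; revert f s t El.
induction l as [l IH] using (well_founded_induction Wf_nat.lt_wf).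
intros f s t -> W Hs Ht PX PY.
assert (Hc : closest f s t).
  intros x y Hx Hy Hxy Px Py.
  destruct (Z.lt_trichotomy x y) as [Hlt | [-> | Hlt]].
  - apply (IH (Z.to_nat (y - x)) ltac:(lia) f x y erefl); auto; lia.
  - destruct Px, Py; congruence.
  - apply (IH (Z.to_nat (x - y)) ltac:(lia) (fun z => swap (f z)) y x erefl);
      try lia; [now apply dominated_swap | |].
      destruct Py as [E1 E2]; split; now rewrite ?E1 ?E2.
    destruct Px as [E1 E2]; split; now rewrite ?E1 ?E2.
assert (H := dom_free W).
destruct (Z.Even_or_Odd (t - s)) as [[h Hh] | [h Hh]].
- destruct PX as [S1 S2], PY as [T1 T2].
  assert (Hadj := dom_adj W); unfold adjacent in Hadj.
  third H S1 T1 (s + h) as [E1 | E1]; third H S2 T2 (s + h + 1) as [E2 | E2].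
  + apply (Hc (s + h) t); try lia; split; auto.
  + apply (Hadj (s + h) (s + h + 1)); auto; lia.
  + apply (Hadj (s + h + 1) (s + h)); auto; lia.
  + apply (Hc s (s + h)); try lia; split; auto.
- assert (Hst : s + 1 < t).
    destruct (Z.eq_dec t (s + 1)) as [-> | ?]; [| lia].
    destruct PX, PY; congruence.
  set (m := s + h + 1).
  destruct (PX) as [S1 S2], (PY) as [T1 T2].
  third H S1 T2 m as [E | E].
    apply (closest_middle_not_X (m:=m) W Hc); auto; lia.
  (* If the middle is [Y], reversing the word and exchanging [X] and [Y] helps. *)
  set (g := fun z => swap (flip n f z)).
  apply (@closest_middle_not_X g n (n - 2 - t) (n - 2 - s) (n - 1 - m)).
  + now apply dominated_swap, dominated_flip.
  + intros x y Hx Hy Hxy [Ex1 Ex2] [Ey1 Ey2].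
    apply swapK in Ex1; apply swapK in Ex2; apply swapK in Ey1; apply swapK in Ey2.
    unfold flip in *; cbn in *.
    apply (Hc (n - 1 - (y + 1)) (n - 1 - (x + 1))); try lia; split; auto.
    * now replace (n - 1 - (y + 1) + 1) with (n - 1 - y) by lia.
    * now replace (n - 1 - (x + 1) + 1) with (n - 1 - x) by lia.
  + lia.
  + lia.
  + unfold g, flip; split.
    * now replace (n - 1 - (n - 2 - t)) with (t + 1) by lia; rewrite T2.
    * now replace (n - 1 - (n - 2 - t + 1)) with t by lia; rewrite T1.
  + unfold g, flip; split.
    * now replace (n - 1 - (n - 2 - s)) with (s + 1) by lia; rewrite S2.
    * now replace (n - 1 - (n - 2 - s + 1)) with s by lia; rewrite S1.
  + lia.
  + unfold m; lia.
  + unfold g, flip; now replace (n - 1 - (n - 1 - m)) with m by lia; rewrite E.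
Qed.

(** * Gaps between isolated letters *)

Record word (f : Z -> color) (n : Z) : Prop := {
  word_dominated : dominated f n;
  word_YY : forall x y, 0 <= x < n -> 0 <= y < n -> adjacent x y ->
    f x = Y -> f y = Y -> False }.

Lemma word_free {f n} : word f n -> rainbow_free f n.
Proof. intros [[H _] _]; exact H. Qed.

Lemma word_flip {f n} : word f n -> word (flip n f) n.
Proof.
intros [W N]; split; [now apply dominated_flip |].
intros x y Hx Hy Hxy; apply N; unfold adjacent in *; lia.
Qed.

Lemma Y_neighbor {f n x y} : word f n -> 0 <= x < n -> 0 <= y < n -> adjacent y x ->
  f y = Y -> f x = D.
Proof.
intros [[_ A] N] Hx Hy Hxy Ey; destruct (f x) eqn:Ex; auto; exfalso.
- apply (A x y); auto; unfold adjacent in *; lia.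
- apply (N y x); auto.
Qed.

Lemma pair_intro {f n x} : word f n -> 0 <= x -> x + 1 < n ->
  f x <> D -> f (x + 1) <> D -> pair_at f X x.
Proof.
intros [[_ A] N] Hx Hx1 E1 E2; unfold adjacent in *.
destruct (f x) eqn:F1, (f (x + 1)) eqn:F2; try congruence; try now split.
- exfalso; apply (A x (x + 1)); auto; lia.
- exfalso; apply (A (x + 1) x); auto; lia.
- exfalso; apply (N x (x + 1)); auto; lia.
Qed.

(** The mirror images of the two letters are different from [D], and neighboring
    letters different from [D] can only be [X]. *)
Lemma pair_reflect {f n v y} : word f n -> pair_at f X v -> f y = Y ->
  0 <= v -> v + 1 < n -> 0 <= y < n -> 0 <= 2 * y - v - 1 -> 2 * y - v < n ->
  pair_at f X (2 * y - v - 1).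
Proof.
intros W [V1 V2] Ey Hv Hv1 Hy H1 H2.
apply (pair_intro W); try lia; intros E.
- rainbow (word_free W) V2 Ey E.
- rainbow (word_free W) V1 Ey E.
Qed.

(** Of two pairs on different sides of the gap, the one nearer to it can be
    reflected over the end of the gap next to it without leaving the stretch
    between the two pairs. This gives a pair between them, and so on, until
    one lies in the gap. *)
Lemma gap_has_pair {f n y y' u w} : word f n -> f y = Y -> f y' = Y ->
  0 <= u -> u < y -> y < y' -> y' < w -> w + 1 < n ->
  pair_at f X u -> pair_at f X w ->
  exists x, y < x /\ x + 1 < y' /\ pair_at f X x.
Proof.
intros W Ey Ey' Hu Huy Hyy' Hw Hw1 Pu Pw.
remember (Z.to_nat (w - u)) as l eqn:El; revert u w El Hu Huy Hw Hw1 Pu Pw.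
induction l as [l IH] using (well_founded_induction Wf_nat.lt_wf).
intros u w -> Hu Huy Hw Hw1 Pu Pw.
assert (Hin : forall x, u < x < w -> pair_at f X x ->
          exists z, y < z /\ z + 1 < y' /\ pair_at f X z).
  intros x Hx Px.
  assert (x <> y /\ x + 1 <> y /\ x <> y' /\ x + 1 <> y').
    destruct Px; repeat split; intros E; congruence.
  destruct (Z_lt_le_dec x y).
    apply (IH (Z.to_nat (w - x)) ltac:(lia) x w); auto; lia.
  destruct (Z_lt_le_dec y' x).
    apply (IH (Z.to_nat (x - u)) ltac:(lia) u x); auto; lia.
  exists x; repeat split; try apply Px; lia.
destruct (Z_lt_le_dec u (2 * y' - w - 1)).
  apply (Hin (2 * y' - w - 1)); [lia |].
  apply (pair_reflect W Pw Ey'); lia.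
apply (Hin (2 * y - u - 1)); [lia |].
apply (pair_reflect W Pu Ey); lia.
Qed.

Definition first_pair (f : Z -> color) (n v : Z) : Prop :=
  [/\ 0 <= v, v + 1 < n, pair_at f X v & forall x, 0 <= x < v -> ~ pair_at f X x].

(** Otherwise the reflection over [y] would be an earlier pair. *)
Lemma first_pair_half {f n v y} : word f n -> first_pair f n v ->
  0 <= y < v -> f y = Y -> 2 * y <= v.
Proof.
intros W [Hv Hv1 Pv Hmin] Hy Ey.
destruct (Z_lt_le_dec v (2 * y)) as [Hlt | ?]; [exfalso | auto].
apply (Hmin (2 * y - v - 1)); [lia |].
apply (pair_reflect W Pv Ey); lia.
Qed.

(** The border of width [b] is needed because windows around two letters [Y]
    have to fit into the word. *)
Definition Yfree (f : Z -> color) (v b d : Z) : Prop :=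
  forall y, b <= y -> y + d < v -> f y = Y -> f (y + d) = Y -> False.

Lemma Yfree_le {f v b b' d} : b <= b' -> Yfree f v b d -> Yfree f v b' d.
Proof. intros Hb H y Hy; apply H; lia. Qed.

Lemma Yfree_1 {f n v} : word f n -> v <= n -> Yfree f v 0 1.
Proof.
intros W Hv y Hy Hyv E1 E2; apply (word_YY W (x:=y) (y:=y + 1)); auto;
  unfold adjacent; lia.
Qed.

(** One letter of the first pair has the parity of [y]. Its middles with [y] and
    [y + 2] are neighbors, so they form an earlier pair. *)
Lemma Yfree_2 {f n v} : word f n -> first_pair f n v -> Yfree f v 0 2.
Proof.
intros W [Hv Hv1 [V1 V2] Hmin] y Hy Hyv E1 E2; assert (H := word_free W).
assert (He : exists e h, (e = v \/ e = v + 1) /\ e = y + 2 * h).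
  destruct (Z.Even_or_Odd (v - y)) as [[h Hh] | [h Hh]].
    exists v, h; lia.
  exists (v + 1), (h + 1); lia.
destruct He as (e & h & He & Hh).
assert (Ee : f e = X) by (destruct He as [-> | ->]; auto).
apply (Hmin (y + h)); [lia |].
apply (pair_intro W); try lia; intros E.
- rainbow H E1 Ee E.
- rainbow H E2 Ee E.
Qed.

(** The middle of an [X] and that end of the gap which has the right parity is
    [X] or [Y], and a second [X] at distance less than [m] excludes [Y], as its
    mirror image lies in the window. So two such letters move to two distinct
    letters of the same kind that are nearer to the gap, until one of them
    falls into the window. *)
Lemma window_X_apart {f n y m} : rainbow_free f n -> Z.Odd m -> 0 < m ->
  f y = Y -> f (y + m) = Y -> 0 <= y - m + 1 -> y + 2 * m - 1 < n ->
  (forall x, y - m < x < y + 2 * m -> x <> y -> x <> y + m -> f x = D) ->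
  forall x1 x2, 0 <= x1 < n -> 0 <= x2 < n -> x1 <> x2 -> Z.abs (x1 - x2) < m ->
  f x1 = X -> f x2 = X -> False.
Proof.
intros H [h Hh] Hm E1 E2 HL HR HW x1 x2.
remember (Z.to_nat (Z.abs (2 * (x1 - y) - m) + Z.abs (2 * (x2 - y) - m))) as l eqn:El.
revert x1 x2 El.
induction l as [l IH] using (well_founded_induction Wf_nat.lt_wf).
intros x1 x2 -> R1 R2 Hne Hd F1 F2.
assert (Hout : forall x, f x = X -> x <= y - m \/ y + 2 * m <= x).
  intros x Ex; destruct (Z.eq_dec x y) as [-> | ?]; [congruence |].
  destruct (Z.eq_dec x (y + m)) as [-> | ?]; [congruence |].
  destruct (Z_lt_le_dec (y - m) x); [| lia].
  destruct (Z_lt_le_dec x (y + 2 * m)); [| lia].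
  rewrite HW in Ex; [discriminate | lia | lia | lia].
assert (O1 := Hout x1 F1); assert (O2 := Hout x2 F2).
assert (Hhalf : forall a b, 0 <= a < n -> 0 <= b < n -> a <> b -> Z.abs (a - b) < m ->
  f a = X -> f b = X ->
  exists z a', (z = y \/ z = y + m) /\ 2 * a' = a + z /\ f a' = X).
  intros a b Ha Hb Hab Hdab Fa Fb.
  assert (Hz : exists z a', (z = y \/ z = y + m) /\ 2 * a' = a + z).
    destruct (Z.Even_or_Odd (a - y)) as [[t Ht] | [t Ht]].
      exists y, (y + t); lia.
    exists (y + m), (y + t + h + 1); lia.
  destruct Hz as (z & a' & Hz & Ha'); exists z, a'; repeat split; auto.
  assert (Ez : f z = Y) by (destruct Hz as [-> | ->]; auto).
  assert (Oa := Hout a Fa).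
  third H Fa Ez a' as [E | E]; [exact E |].
  assert (Ec : f (2 * a' - b) = D) by (apply HW; lia).
  rainbow H Fb E Ec.
destruct (Hhalf x1 x2) as (z1 & w1 & Hz1 & Hw1 & G1); auto.
destruct (Hhalf x2 x1) as (z2 & w2 & Hz2 & Hw2 & G2); auto; try lia.
apply (IH (Z.to_nat (Z.abs (2 * (w1 - y) - m) + Z.abs (2 * (w2 - y) - m)))
          ltac:(lia) w1 w2 erefl); auto; lia.
Qed.

(** * The inside of a short gap *)

(** If no [Y] lies inside the gap, letters [D] propagate: [D] at [i] forces [D] at
    each [j] such that [i], [j] and an end of the gap, taken in some order, form
    a progression. *)
Definition grow (m : nat) (s : seq nat) : seq nat :=
  [seq j <- iota 1 m.-1 |
    [|| j \in s, j.*2 \in s, ~~ odd j && (j./2 \in s),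
        (m < j.*2)%N && ((j.*2 - m)%N \in s)
      | ~~ odd (j + m) && ((j + m)./2 \in s)]].

(** Places of a gap of length [m] that are [D] because the neighbors of its ends
    are. *)
Definition forced (m : nat) : seq nat := iter m (grow m) [:: 1%N; m.-1].

Definition gap (f : Z -> color) (y m : Z) : Prop :=
  [/\ f y = Y, f (y + m) = Y & forall x, y < x < y + m -> f x <> Y].

Lemma forced_D {f n y} {m : nat} : word f n -> 0 <= y -> y + Z.of_nat m < n ->
  (1 < m)%N -> gap f y (Z.of_nat m) ->
  forall j, (j \in forced m) -> f (y + Z.of_nat j) = D.
Proof.
intros W Hy Hym Hm [E1 E2 Hin]; assert (H := word_free W).
assert (Hs : forall s : seq nat,
  (forall j, j \in s -> (0 < j < m)%N /\ f (y + Z.of_nat j) = D) ->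
  forall j, j \in grow m s -> (0 < j < m)%N /\ f (y + Z.of_nat j) = D).
  intros s IH j; rewrite mem_filter mem_iota => /andP[Hj Hr].
  assert (Hjm : (0 < j < m)%N) by lia; split; [exact Hjm |].
  assert (Hnot := Hin (y + Z.of_nat j) ltac:(lia)).
  case/or4P: Hj => [Hj | Hj | /andP[Ho Hj] | /orP[/andP[Ho Hj] | /andP[Ho Hj]]];
    destruct (IH _ Hj) as [Hr' F].
  - exact F.
  - third H E1 F (y + Z.of_nat j) as [G | G]; [contradiction | exact G].
  - third H E1 F (y + Z.of_nat j) as [G | G]; [contradiction | exact G].
  - third H E2 F (y + Z.of_nat j) as [G | G]; [contradiction | exact G].
  - third H E2 F (y + Z.of_nat j) as [G | G]; [contradiction | exact G].
assert (Hi : forall i j, j \in iter i (grow m) [:: 1%N; m.-1] ->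
          (0 < j < m)%N /\ f (y + Z.of_nat j) = D).
  induction i as [|i IH]; [| exact (Hs _ IH)].
  intros j; rewrite !inE => /orP[/eqP -> | /eqP ->]; (split; [lia |]).
    apply (Y_neighbor (y:=y) W); auto; unfold adjacent; lia.
  apply (Y_neighbor (y:=y + Z.of_nat m) W); auto; unfold adjacent; lia.
intros j Hj; apply (Hi _ _ Hj).
Qed.

Lemma forced_all :
  all (fun m => all (fun j => j \in forced m) (iota 1 m.-1)) [:: 3; 4; 5; 7; 8]%N.
Proof. by vm_compute. Qed.

(** The places that are not forced in a gap of length at most 16 are multiples of
    a common odd divisor, except for length 15, where there are two such
    divisors, 3 and 5, with neighboring multiples. *)
Lemma forced_no_pair :
  all (fun m => (m == 15%N) ||
         all (fun j => (j \in forced m) || (j.+1 \in forced m)) (iota 1 m.-2))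
      (iota 2 15).
Proof. by vm_compute. Qed.

Lemma short_gap_D {f n y} {m : nat} : word f n -> 0 <= y -> y + Z.of_nat m < n ->
  m \in [:: 3; 4; 5; 7; 8]%N -> gap f y (Z.of_nat m) ->
  forall x, y < x < y + Z.of_nat m -> f x = D.
Proof.
intros W Hy Hym Hm G x Hx.
assert (Hf := allP forced_all m Hm).
assert (Hm1 : (1 < m)%N).
  by move: Hm; rewrite !inE => /or4P[/eqP -> | /eqP -> | /eqP -> | /orP[/eqP -> | /eqP ->]].
assert (Hj := allP Hf (Z.to_nat (x - y))).
rewrite mem_iota in Hj.
assert (E := forced_D W Hy Hym Hm1 G (Hj ltac:(lia))).
now replace (y + Z.of_nat (Z.to_nat (x - y))) with x in E by lia.
Qed.

Lemma gap_with_pair {f n y m x} : word f n -> 0 <= y -> y + m < n -> 0 < m ->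
  gap f y m -> y < x -> x + 1 < y + m -> pair_at f X x -> 17 <= m \/ m = 15.
Proof.
intros W Hy Hym Hm0 G Hx Hxm [E1 E2].
destruct (Z_lt_le_dec m 17) as [Hm | ?]; [| now left].
destruct (Z.eq_dec m 15) as [-> | Hne]; [now right | exfalso].
assert (Hc := allP forced_no_pair (Z.to_nat m)); cbn beta in Hc.
rewrite mem_iota in Hc; specialize (Hc ltac:(lia)).
case/orP: Hc => [/eqP Hc | Hc]; [lia |].
assert (Hj := allP Hc (Z.to_nat (x - y))); cbn beta in Hj.
rewrite mem_iota in Hj; specialize (Hj ltac:(lia)).
replace m with (Z.of_nat (Z.to_nat m)) in G, Hym by lia.
case/orP: Hj => Hj.
- assert (E := forced_D W Hy Hym ltac:(lia) G Hj).
  replace (y + Z.of_nat (Z.to_nat (x - y))) with x in E by lia; congruence.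
- assert (E := forced_D W Hy Hym ltac:(lia) G Hj).
  replace (y + Z.of_nat (Z.to_nat (x - y)).+1) with (x + 1) in E by lia; congruence.
Qed.

(** * Short gaps left of the first pair *)

Lemma first_pair_room {f n v y m} : word f n -> first_pair f n v ->
  0 <= y -> 0 < m -> y + m < v -> f (y + m) = Y -> y + 2 * m <= v - y.
Proof.
intros W F Hy Hm Hv E.
assert (H := first_pair_half W F (y:=y + m) ltac:(lia) E); lia.
Qed.

Lemma Yfree_gap {f v b y m} : 0 <= b -> b <= y -> y + m < v ->
  (forall d, 0 < d < m -> Yfree f v b d) -> f y = Y -> f (y + m) = Y -> gap f y m.
Proof.
intros Hb Hy Hv Hfree E1 E2; split; auto; intros x Hx Ex.
apply (Hfree (x - y) ltac:(lia) y); auto; [lia |].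
now replace (y + (x - y)) with x by lia.
Qed.

(** Reflecting the inside of the gap over its ends gives a window of letters [D],
    in which no two neighboring letters [X] can be. *)
Lemma Yfree_odd {f n v b} {m : nat} : word f n -> first_pair f n v -> 0 <= b ->
  m \in [:: 3; 5; 7]%N ->
  (forall d, 0 < d < Z.of_nat m -> Yfree f v b d) ->
  Yfree f v (b + Z.of_nat m - 1) (Z.of_nat m).
Proof.
intros W F Hb Hm Hfree y Hy Hyv E1 E2; assert (H := word_free W).
assert (Hm3 : 3 <= Z.of_nat m).
  by move: Hm; rewrite !inE => /or3P[/eqP -> | /eqP -> | /eqP ->].
assert (Hodd : Z.Odd (Z.of_nat m)).
  move: Hm; rewrite !inE => /or3P[/eqP -> | /eqP -> | /eqP ->];
    [exists 1 | exists 2 | exists 3]; lia.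
assert (Hroom := first_pair_room W F (y:=y) (m:=Z.of_nat m)
                   ltac:(lia) ltac:(lia) Hyv E2).
destruct F as [Hv Hv1 [V1 V2] Hmin].
assert (Hin : forall x, y < x < y + Z.of_nat m -> f x = D).
  apply (short_gap_D W); try lia.
    by move: Hm; rewrite !inE => /or3P[/eqP -> | /eqP -> | /eqP ->].
  apply (Yfree_gap Hb (v:=v)); auto; lia.
apply (@window_X_apart f n y (Z.of_nat m)) with (x1 := v) (x2 := v + 1); auto; try lia.
intros x Hx Hx0 Hxm.
destruct (Z_lt_le_dec x y) as [Hl | Hl].
  third H E1 (Hin (2 * y - x) ltac:(lia)) x as [E | E]; [exfalso | exact E].
  apply (Hfree (y - x) ltac:(lia) x); try lia; auto.
  now replace (x + (y - x)) with y by lia.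
destruct (Z_lt_le_dec x (y + Z.of_nat m)) as [Hr | Hr]; [apply Hin; lia |].
third H E2 (Hin (2 * (y + Z.of_nat m) - x) ltac:(lia)) x as [E | E];
  [exfalso | exact E].
apply (Hfree (x - (y + Z.of_nat m)) ltac:(lia) (y + Z.of_nat m)); try lia; auto.
now replace (y + Z.of_nat m + (x - (y + Z.of_nat m))) with x by lia.
Qed.

Lemma pair_parity {v} y : exists e t, (e = v \/ e = v + 1) /\ e = y + 2 * t.
Proof.
destruct (Z.Even_or_Odd (v - y)) as [[h Hh] | [h Hh]].
  exists v, h; lia.
exists (v + 1), (h + 1); lia.
Qed.

(** This middle is [X] or [Y], and if it were [Y], the reflection of the pair
    over it would cover [y]. *)
Lemma middle_X {f n v y e x} : word f n -> first_pair f n v ->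
  0 < y < v -> f y = Y -> e = v \/ e = v + 1 -> e + y = 2 * x -> f x = X.
Proof.
intros W [Hv Hv1 [V1 V2] Hmin] Hy Ey He Hx; assert (H := word_free W).
assert (Ee : f e = X) by (destruct He as [-> | ->]; auto).
third H Ey Ee x as [E | E]; [exfalso | exact E].
destruct (pair_reflect W (conj V1 V2) E ltac:(lia) ltac:(lia) ltac:(lia)
            ltac:(lia) ltac:(lia)) as [P1 P2].
destruct He as [-> | ->].
- replace (2 * x - v - 1 + 1) with y in P2 by lia; congruence.
- replace (2 * x - v - 1) with y in P1 by lia; congruence.
Qed.

(** Here [e] is the letter of the first pair with the parity of [y]. Reflections
    over [y - 2h] and [y] turn [e] and its middle with [y] into two lattices of
    letters [X], the places [e - 2hk] and the places [y + t - hk]. The first one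
    descends into the window of letters [D] next to [y] and hits a [D] there, as
    [h] does not divide [t]. The letter [D] at [y + 2h] is the reason for taking the last two letters [Y] at that distance. *)
Lemma even_gap_lattice {f n v h y e t} : word f n -> first_pair f n v -> 0 < h ->
  f (y - 2 * h) = Y -> f y = Y -> 0 <= y - 2 * h -> y < v ->
  (forall i, 0 < i < 2 * h -> f (y - i) = D /\ f (y + i) = D) ->
  f (y + 2 * h) = D -> Yfree f v (y - h) h ->
  e = v \/ e = v + 1 -> e = y + 2 * t -> t mod h <> 0 -> False.
Proof.
intros W F Hh E0 E1 Hy0 Hyv HW E2 Hfree He Ht Hth; assert (H := word_free W).
assert (Hhalf := first_pair_half W F (y:=y) ltac:(lia) E1).
assert (Hmid := @middle_X f n v y e (y + t) W F ltac:(lia) E1 He ltac:(lia)).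
destruct F as [Hv Hv1 [V1 V2] Hmin].
assert (Ee : f e = X) by (destruct He as [-> | ->]; auto).
assert (Hmodh := Z.mod_pos_bound t h Hh).
assert (Hdivh := Z.div_mod t h ltac:(lia)).
(* A letter other than [D] at number [k] of the lattice is [X], if those up to
   number [k - 2] are. Suppose it is [Y]. In the right half, reflecting the
   first pair over it gives an earlier pair. In the left half, one of the
   known letters [X] is reflected over it to a [D] in the gap before [y].
   Places nearer than [2h] to [y] are [D] anyway. *)
assert (Hz : forall k, 0 <= k -> y - 2 * h < e - 2 * (h * k) -> 0 < k ->
  (forall j, 0 <= j <= k - 2 -> f (e - 2 * (h * j)) = X) ->
  f (e - 2 * (h * k)) <> D -> f (e - 2 * (h * k)) = X).
  intros k Hk Hkz Hk0 Hj Hne; set (z := e - 2 * (h * k)) in *.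
  destruct (f z) eqn:Ez; [congruence | auto | exfalso].
  assert (Hzy : z - y = 2 * (h * (t / h - k) + t mod h)) by lia.
  set (q := t / h - k) in *; set (r := t mod h) in *.
  destruct (Z_lt_le_dec z (y + 2 * h)) as [Hlt | Hge].
    destruct (Z_lt_le_dec z y) as [Hzl | Hzl].
      destruct (HW (y - z) ltac:(lia)) as [Hd _].
      replace (y - (y - z)) with z in Hd by lia; congruence.
    assert (z <> y) by (intros E; destruct (Z_lt_le_dec q 0); nia).
    destruct (HW (z - y) ltac:(lia)) as [_ Hd].
    replace (y + (z - y)) with z in Hd by lia; congruence.
  assert (Hq : 1 <= q) by (destruct (Z_lt_le_dec q 1); nia).
  assert (Hzv : z < v) by (assert (h * 1 <= h * k) by nia; lia).
  destruct (Z_lt_le_dec v (2 * z)) as [Hzz | Hzz].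
    apply (Hmin (2 * z - v - 1)); [lia |].
    apply (pair_reflect W (conj V1 V2) Ez); lia.
  destruct (HW (2 * h - 2 * r) ltac:(lia)) as [Hd _].
  assert (Hkq : 0 <= k - q - 1) by nia.
  assert (Ej := Hj (k - q - 1) ltac:(lia)).
  rainbow H Ej Ez Hd.
assert (HP : forall k, 0 <= k -> y < e - 2 * (h * k) ->
          f (e - 2 * (h * k)) = X /\ f (y + t - h * k) = X).
  intros k; remember (Z.to_nat k) as l eqn:El; revert k El.
  induction l as [l IH] using (well_founded_induction Wf_nat.lt_wf).
  intros k -> Hk Hky.
  destruct (Z.eq_dec k 0) as [-> | Hk0].
    replace (e - 2 * (h * 0)) with e by lia.
    replace (y + t - h * 0) with (y + t) by lia; auto.
  assert (IH' : forall j, 0 <= j <= k - 1 ->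
            f (e - 2 * (h * j)) = X /\ f (y + t - h * j) = X).
    intros j Hj; apply (IH (Z.to_nat j)); try lia; nia.
  clear IH; destruct (IH' (k - 1) ltac:(lia)) as [P1 P2].
  assert (Hhk : h * 1 <= h * k) by nia.
  assert (Q : f (y + t - h * k) = X).
    third H E0 P1 (y + t - h * k) as [Q | Q]; [exfalso | exact Q].
    third H P2 Q (y + t - h * (k + 1)) as [R | R]; cycle 1.
      apply (Hfree (y + t - h * (k + 1))); try lia; auto.
      now replace (y + t - h * (k + 1) + h) with (y + t - h * k) by lia.
    assert (Hez : f (e - 2 * (h * (k + 1))) = X).
      apply Hz; try lia.
        intros j Hj; apply IH'; lia.
      intros E; rainbow H E1 R E.
    rainbow H Hez Q E2.
  split; [| exact Q].
  apply Hz; try lia.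
    intros j Hj; apply IH'; lia.
  intros E; rainbow H E1 Q E.
assert (Ht0 : 0 <= t / h) by (apply Z.div_pos; lia).
destruct (HP (t / h) Ht0 ltac:(lia)) as [P _].
destruct (HW (2 * (t mod h)) ltac:(lia)) as [_ Hd].
replace (y + 2 * (t mod h)) with (e - 2 * (h * (t / h))) in Hd by lia.
congruence.
Qed.

(** If the lattices of the previous lemma miss the letters [D], repeated halving
    gives letters other than [D] at distance two from each other. Two of these
    are [X], and their middles with [y] form an earlier pair. *)
Lemma Yfree_even {f n v b h} : word f n -> first_pair f n v -> 1 <= b ->
  h = 2 \/ h = 4 -> (forall d, 0 < d < 2 * h -> Yfree f v b d) ->
  Yfree f v b (2 * h).
Proof.
intros W F Hb Hh Hfree y0.
remember (Z.to_nat (v - y0)) as l eqn:El; revert y0 El.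
induction l as [l IH] using (well_founded_induction Wf_nat.lt_wf).
intros y0 -> Hy0 Hyv E0 E1; assert (H := word_free W).
set (y := y0 + 2 * h) in *.
assert (Hroom := first_pair_room W F (y:=y0) (m:=2 * h)
                   ltac:(lia) ltac:(lia) ltac:(lia) E1).
assert (Hin : forall x, y0 < x < y0 + 2 * h -> f x = D).
  destruct F as [Hv Hv1 _ _].
  assert (Hm : Z.of_nat (Z.to_nat (2 * h)) = 2 * h) by lia.
  intros x Hx; apply (short_gap_D (y:=y0) (m:=Z.to_nat (2 * h)) W); rewrite ?Hm; try lia.
    by case: Hh => ->.
  apply (Yfree_gap (b:=b) (v:=v)); auto; lia.
assert (HW : forall i, 0 < i < 2 * h -> f (y - i) = D /\ f (y + i) = D).
  intros i Hi; assert (Ei : f (y - i) = D) by (apply Hin; lia).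
  destruct F as [Hv Hv1 _ _].
  split; [exact Ei |].
  third H E1 Ei (y + i) as [E | E]; [exfalso | exact E].
  apply (Hfree i Hi y); auto; lia.
assert (E2 : f (y + 2 * h) = D).
  assert (Hne : f (y + 2 * h) <> Y).
    intros E; destruct F as [Hv Hv1 [V1 V2] _].
    destruct (Z.eq_dec (y + 2 * h) v) as [Hv' | ?]; [congruence |].
    apply (IH (Z.to_nat (v - y)) ltac:(lia) y erefl); auto; lia.
  destruct (f (y + 2 * h)) eqn:E; auto; [exfalso | congruence].
  destruct F as [Hv Hv1 _ _].
  rainbow H E1 (proj2 (HW h ltac:(lia))) E.
destruct (@pair_parity v y) as (e & t & He & Ht).
destruct (Z.eq_dec (t mod h) 0) as [Ht0 | Ht0]; cycle 1.
  apply (@even_gap_lattice f n v h y e t W F); auto; try lia.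
    now replace (y - 2 * h) with y0 by lia.
  apply (@Yfree_le f v b); [lia |]; apply Hfree; lia.
assert (Hdiv := Z.div_mod t h ltac:(lia)); rewrite Ht0 in Hdiv.
set (s := t / h) in *.
assert (M1 := @middle_X f n v y e (y + h * s) W F ltac:(lia) E1 He ltac:(lia)).
assert (M2 := @middle_X f n v y0 e (y + h * s - h) W F ltac:(lia) E0 He ltac:(lia)).
destruct F as [Hv Hv1 _ Hmin].
(* Two consecutive elements of the right parity have middles with [y] that
   form a pair. *)
assert (Hpair : forall a, y - v < 2 * a < 2 * (v - y) ->
          f (y + 2 * a) = X -> f (y + 2 * a - 2) = X -> 0 <= y + 2 * a - 2 ->
          y + 2 * a < n -> False).
  intros a Ha A1 A2 Hl Hr; apply (Hmin (y + a - 1)); [lia |].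
  apply (pair_intro W); try lia; intros E.
  - rainbow H E1 A2 E.
  - rainbow H E1 A1 E.
destruct Hh as [-> | ->].
- apply (Hpair s); auto; lia.
- assert (N0 : f (y + 2 * s) <> D) by (intros E; rainbow H E1 M1 E).
  assert (N2 : f (y + 2 * s - 2) <> D) by (intros E; rainbow H E1 M2 E).
  assert (N4 : f (y + 2 * s - 4) <> D) by (intros E; rainbow H E0 M1 E).
  assert (N6 : f (y + 2 * s - 6) <> D) by (intros E; rainbow H E0 M2 E).
  assert (A0 := Hpair s); assert (A2 := Hpair (s - 1)); assert (A4 := Hpair (s - 2)).
  replace (y + 2 * (s - 1)) with (y + 2 * s - 2) in A2 by lia.
  replace (y + 2 * s - 2 - 2) with (y + 2 * s - 4) in A2 by lia.
  replace (y + 2 * (s - 2)) with (y + 2 * s - 4) in A4 by lia.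
  replace (y + 2 * s - 4 - 2) with (y + 2 * s - 6) in A4 by lia.
  assert (B1 := Hfree 2 ltac:(lia) (y + 2 * s - 2)).
  assert (B2 := Hfree 2 ltac:(lia) (y + 2 * s - 4)).
  assert (B3 := Hfree 2 ltac:(lia) (y + 2 * s - 6)).
  assert (B4 := Hfree 4 ltac:(lia) (y + 2 * s - 4)).
  assert (B5 := Hfree 4 ltac:(lia) (y + 2 * s - 6)).
  replace (y + 2 * s - 2 + 2) with (y + 2 * s) in B1 by lia.
  replace (y + 2 * s - 4 + 2) with (y + 2 * s - 2) in B2 by lia.
  replace (y + 2 * s - 6 + 2) with (y + 2 * s - 4) in B3 by lia.
  replace (y + 2 * s - 4 + 4) with (y + 2 * s) in B4 by lia.
  replace (y + 2 * s - 6 + 4) with (y + 2 * s - 2) in B5 by lia.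
  destruct (f (y + 2 * s)) eqn:F0; try congruence;
  destruct (f (y + 2 * s - 2)) eqn:F2; try congruence;
  destruct (f (y + 2 * s - 4)) eqn:F4; try congruence;
  destruct (f (y + 2 * s - 6)) eqn:F6; try congruence;
  first [ apply A0; auto; lia | apply A2; auto; lia | apply A4; auto; lia
        | apply B1; auto; lia | apply B2; auto; lia | apply B3; auto; lia
        | apply B4; auto; lia | apply B5; auto; lia ].
Qed.

Ltac dlia := Z.to_euclidean_division_equations; lia.

(** * Both sides of the pairs *)

Definition two_sided (f : Z -> color) (n v v' : Z) : Prop :=
  [/\ word f n, first_pair f n v & first_pair (flip n f) n v'].

Lemma flipK {f : Z -> color} {n x} : flip n f (n - 1 - x) = f x.
Proof. unfold flip; f_equal; lia. Qed.

Lemma two_sided_flip {f n v v'} : two_sided f n v v' -> two_sided (flip n f) n v' v.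
Proof.
intros [W F F']; split; [now apply word_flip | exact F' |].
destruct F as [Hv Hv1 [V1 V2] Hmin]; split; auto.
- split; unfold flip; [now replace (n - 1 - (n - 1 - v)) with v by lia |].
  now replace (n - 1 - (n - 1 - (v + 1))) with (v + 1) by lia.
- intros x Hx [P1 P2]; unfold flip in P1, P2; apply (Hmin x Hx); split.
    now replace (n - 1 - (n - 1 - x)) with x in P1 by lia.
  now replace (n - 1 - (n - 1 - (x + 1))) with (x + 1) in P2 by lia.
Qed.

Lemma gap_cases {f n v v' y m} : two_sided f n v v' -> gap f y m ->
  0 <= y -> 0 < m -> y + m < n ->
  [\/ y + m < v, n - 1 - v' < y |
      exists x, y < x /\ x + 1 < y + m /\ pair_at f X x].
Proof.
intros [W [Hv Hv1 Pv _] [Hw Hw1 [P1 P2] _]] [E1 E2 _] Hy Hm Hym.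
set (w := n - 2 - v').
assert (Pw : pair_at f X w).
  unfold flip in P1, P2; split; unfold w.
    now replace (n - 1 - (v' + 1)) with (n - 2 - v') in P2 by lia.
  now replace (n - 2 - v' + 1) with (n - 1 - v') by lia.
assert (Hne : v <> y + m /\ v + 1 <> y + m /\ v <> y /\ v + 1 <> y /\
              w <> y /\ w + 1 <> y /\ w <> y + m /\ w + 1 <> y + m).
  destruct Pv, Pw; repeat split; intros E; congruence.
destruct (Z_lt_le_dec (y + m) v); [now apply Or31 |].
destruct (Z_lt_le_dec (w + 1) y); [apply Or32; lia |].
apply Or33.
destruct (Z_lt_le_dec y v) as [? | ?]; [exists v; repeat split; try apply Pv; lia |].
destruct (Z_lt_le_dec w (y + m)) as [? | ?];
  [exists w; repeat split; try apply Pw; lia |].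
apply (gap_has_pair W E1 E2 (u:=v) (w:=w)); auto; lia.
Qed.

Lemma short_gap_false {f n v v' b y m} : two_sided f n v v' -> gap f y m ->
  Yfree f v b m -> Yfree (flip n f) v' b m ->
  0 < m < 15 -> 0 <= b -> b <= y -> y + m < n - b -> False.
Proof.
intros T G Hl Hr Hm Hb Hy Hym.
destruct (gap_cases T G ltac:(lia) ltac:(lia) ltac:(lia)) as [Hlt | Hlt | (x & Hx & Hx1 & Px)].
- destruct G as [E1 E2 _]; apply (Hl y); auto.
- destruct G as [E1 E2 _]; apply (Hr (n - 1 - (y + m))); try lia.
    now rewrite flipK.
  replace (n - 1 - (y + m) + m) with (n - 1 - y) by lia.
  now rewrite flipK.
- destruct T as [W _ _].
  destruct (@gap_with_pair f n y m x W ltac:(lia) ltac:(lia) ltac:(lia) G Hx Hx1 Px); lia.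
Qed.

Lemma Yfree_upto4 {f n v} : word f n -> first_pair f n v ->
  forall d, 0 < d <= 4 -> Yfree f v 2 d.
Proof.
intros W F.
assert (F1 : Yfree f v 0 1) by (apply (Yfree_1 W); destruct F; lia).
assert (F2 := Yfree_2 W F).
assert (F3 : Yfree f v 2 3).
  apply (Yfree_odd (b:=0) (m:=3) W F); auto; [lia |].
  intros d Hd; assert (Hd' : d = 1 \/ d = 2) by lia; destruct Hd' as [-> | ->]; auto.
assert (F4 : Yfree f v 2 4).
  apply (Yfree_even (b:=2) (h:=2) W F); auto; [lia |].
  intros d Hd; assert (Hd' : d = 1 \/ d = 2 \/ d = 3) by lia.
  destruct Hd' as [-> | [-> | ->]]; auto; apply (@Yfree_le f v 0); auto; lia.
intros d Hd; assert (Hd' : d = 1 \/ d = 2 \/ d = 3 \/ d = 4) by lia.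
destruct Hd' as [-> | [-> | [-> | ->]]]; auto; apply (@Yfree_le f v 0); auto; lia.
Qed.

(** Between two pairs such a gap would contain a pair, for which it is too short,
    and outside the pairs it is excluded from either side. *)
Lemma YY_far {f n v v' x d} : two_sided f n v v' -> d = 2 \/ d = 4 ->
  2 <= x -> x + d < n - 2 -> f x = Y -> f (x + d) = Y -> False.
Proof.
intros T Hd Hx Hxd E1 E2.
assert (T' := two_sided_flip T).
assert (Hne : forall z, 0 <= z < n -> adjacent x z \/ adjacent (x + d) z -> f z <> Y).
  destruct T as [W _ _].
  intros z Hz [Ha | Ha]; [rewrite (Y_neighbor W Hz _ Ha E1); [discriminate | lia] |].
  rewrite (Y_neighbor W Hz _ Ha E2); [discriminate | lia].
assert (H2 : forall z, 2 <= z -> z + 2 < n - 2 -> f z = Y -> f (z + 2) = Y -> False).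
  intros z Hz Hz2 F1 F2.
  apply (@short_gap_false f n v v' 2 z 2 T); auto; try lia.
  - split; auto; intros u Hu; replace u with (z + 1) by lia.
    destruct T as [W _ _].
    rewrite (Y_neighbor (y:=z) W); try lia; auto; [discriminate |].
    unfold adjacent; lia.
  - apply (Yfree_upto4 (n:=n)); try apply T; lia.
  - apply (Yfree_upto4 (n:=n)); try apply T'; lia.
destruct Hd as [-> | ->]; [now apply (H2 x) |].
apply (@short_gap_false f n v v' 2 x 4 T); auto; try lia.
- split; auto; intros u Hu.
  destruct (Z.eq_dec u (x + 2)) as [-> | ?].
    intros E; apply (H2 x); auto; lia.
  apply Hne; unfold adjacent; lia.
- apply (Yfree_upto4 (n:=n)); try apply T; lia.
- apply (Yfree_upto4 (n:=n)); try apply T'; lia.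
Qed.

Lemma XY_apart_2 {f n x y} : word f n -> 0 <= x < n -> 0 <= y < n ->
  x - y = 2 \/ y - x = 2 -> f x = X -> f y = Y -> False.
Proof.
intros W Hx Hy Hxy Ex Ey; destruct Hxy as [Hxy | Hxy].
- assert (E : f (y + 1) = D).
    apply (Y_neighbor (y:=y) W); auto; unfold adjacent; lia.
  rainbow (word_free W) Ex E Ey.
- assert (E : f (y - 1) = D).
    apply (Y_neighbor (y:=y) W); auto; unfold adjacent; lia.
  rainbow (word_free W) Ex E Ey.
Qed.

Lemma XY_apart {f n x y} : word f n -> 0 <= x < n -> 0 <= y < n ->
  x - y = 2 \/ y - x = 2 \/ x - y = 4 \/ y - x = 4 -> f x = X -> f y = Y -> False.
Proof.
intros W Hx Hy Hxy Ex Ey.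
destruct (Z.eq_dec (Z.abs (x - y)) 2); [apply (XY_apart_2 W Hx Hy); auto; lia |].
assert (Hm : exists z, x + y = 2 * z /\ Z.abs (x - z) = 2).
  destruct (Z_lt_le_dec x y); [exists (x + 2) | exists (y + 2)]; lia.
destruct Hm as (z & Hz & Hxz).
third (word_free W) Ex Ey z as [E | E].
- apply (XY_apart_2 (x:=z) (y:=y) W); auto; lia.
- apply (XY_apart_2 (x:=x) (y:=z) W); auto; lia.
Qed.

(** * A gap of length six *)

(** For a gap of length six the place in its middle is not forced, but the
    places of the parity of [y] see a gap of length three. *)
Lemma gap6_window {f n v y} : word f n -> first_pair f n v -> 6 <= y ->
  y + 6 < v -> f y = Y -> f (y + 6) = Y ->
  forall i, -3 < i < 6 -> i <> 0 -> i <> 3 -> f (y + 2 * i) = D.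
Proof.
intros W F Hy Hyv E1 E2; assert (H := word_free W).
assert (Hfree := Yfree_upto4 W F).
assert (Hroom := first_pair_room W F (y:=y) (m:=6) ltac:(lia) ltac:(lia) Hyv E2).
destruct F as [Hv Hv1 _ _].
assert (A1 : f (y + 1) = D) by (apply (Y_neighbor (y:=y) W); auto; unfold adjacent; lia).
assert (A5 : f (y + 5) = D) by (apply (Y_neighbor (y:=y + 6) W); auto; unfold adjacent; lia).
assert (B2 : f (y + 2) = D).
  third H E1 A1 (y + 2) as [E | E]; [exfalso | exact E].
  apply (Hfree 2 ltac:(lia) y); auto; lia.
assert (B4 : f (y + 4) = D).
  third H E2 A5 (y + 4) as [E | E]; [exfalso | exact E].
  apply (Hfree 2 ltac:(lia) (y + 4)); try lia; auto.
  now replace (y + 4 + 2) with (y + 6) by lia.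
intros i Hi Hi0 Hi3.
assert (Hi' : i = -2 \/ i = -1 \/ i = 1 \/ i = 2 \/ i = 4 \/ i = 5) by lia.
destruct Hi' as [-> | [-> | [-> | [-> | [-> | ->]]]]]; auto.
- third H E1 B4 (y + 2 * -2) as [E | E]; [exfalso | exact E].
  apply (Hfree 4 ltac:(lia) (y + 2 * -2)); try lia; auto.
  now replace (y + 2 * -2 + 4) with y by lia.
- third H E1 B2 (y + 2 * -1) as [E | E]; [exfalso | exact E].
  apply (Hfree 2 ltac:(lia) (y + 2 * -1)); try lia; auto.
  now replace (y + 2 * -1 + 2) with y by lia.
- third H E2 B4 (y + 2 * 4) as [E | E]; [exfalso | exact E].
  apply (Hfree 2 ltac:(lia) (y + 6)); try lia; auto.
  now replace (y + 6 + 2) with (y + 2 * 4) by lia.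
- third H E2 B2 (y + 2 * 5) as [E | E]; [exfalso | exact E].
  apply (Hfree 4 ltac:(lia) (y + 6)); try lia; auto.
  now replace (y + 6 + 4) with (y + 2 * 5) by lia.
Qed.

Lemma gap6_X_apart {f n v y} : word f n -> first_pair f n v -> 6 <= y ->
  y + 6 < v -> f y = Y -> f (y + 6) = Y ->
  forall x1 x2, 0 <= x1 < n -> 0 <= x2 < n -> (exists i, x1 = y + 2 * i) ->
  x2 - x1 = 2 \/ x2 - x1 = 4 -> f x1 = X -> f x2 = X -> False.
Proof.
intros W F Hy Hyv E1 E2 x1 x2 H1 H2 [i Hi] H12 F1 F2.
assert (HW := gap6_window W F Hy Hyv E1 E2).
assert (Hroom := first_pair_room W F (y:=y) (m:=6) ltac:(lia) ltac:(lia) Hyv E2).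
destruct F as [Hv Hv1 _ _].
assert (Ha : exists a c, 0 <= a <= 1 /\ y = a + 2 * c).
  destruct (Z.Even_or_Odd y) as [[c Hc] | [c Hc]]; [exists 0, c | exists 1, c]; lia.
destruct Ha as (a & c & Ha & Hc).
set (g := fun j => f (a + 2 * j)).
set (n' := (n - a + 1) / 2).
assert (Hg : rainbow_free g n').
  intros p q r Hp Hq Hr Hpr; unfold g.
  apply (word_free W (a:=a + 2 * p) (b:=a + 2 * q) (c:=a + 2 * r)); unfold n' in *; dlia.
assert (Hd : exists d, (d = 1 \/ d = 2) /\ x2 = x1 + 2 * d).
  destruct H12; [exists 1 | exists 2]; lia.
destruct Hd as (d & Hd & Hx2).
apply (@window_X_apart g n' c 3 Hg) with (x1 := c + i) (x2 := c + i + d);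
  unfold n', g; try dlia.
- now exists 1.
- now replace (a + 2 * c) with y by lia.
- now replace (a + 2 * (c + 3)) with (y + 6) by lia.
- intros x Hx Hx0 Hx3.
  replace (a + 2 * x) with (y + 2 * (x - c)) by lia; apply HW; lia.
- now replace (a + 2 * (c + i)) with x1 by lia.
- now replace (a + 2 * (c + i + d)) with x2 by lia.
Qed.

Lemma gap6_even_apart {f n v v' y} : two_sided f n v v' -> 6 <= y ->
  y + 6 < v -> f y = Y -> f (y + 6) = Y ->
  forall x1 x2, 2 <= x1 -> x2 < n - 2 -> (exists i, x1 = y + 2 * i) ->
  x2 - x1 = 2 \/ x2 - x1 = 4 -> f x1 <> D -> f x2 <> D -> False.
Proof.
intros T Hy Hyv E1 E2 x1 x2 H1 H2 Hi H12 N1 N2.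
destruct (T) as [W F _].
destruct (f x1) eqn:F1, (f x2) eqn:F2; try congruence.
- apply (gap6_X_apart W F Hy Hyv E1 E2 (x1:=x1) (x2:=x2)); auto; lia.
- apply (XY_apart W (x:=x1) (y:=x2)); auto; lia.
- apply (XY_apart W (x:=x2) (y:=x1)); auto; lia.
- apply (@YY_far f n v v' x1 (x2 - x1) T); auto; try lia.
  now replace (x1 + (x2 - x1)) with x2 by lia.
Qed.

(** Twice reflected, [x1] and [x2] yield places of the parity of [y] at distance
    two or four: over [y] both, or over [y] and [y + 6]. *)
Lemma gap6_odd_apart {f n v v' y} : two_sided f n v v' -> 6 <= y ->
  y + 6 < v -> f y = Y -> f (y + 6) = Y ->
  forall x1 x2, 2 <= 2 * x1 - y - 6 -> 2 * x2 - y < n - 2 ->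
  x2 - x1 = 2 \/ x2 - x1 = 4 -> f x1 <> D -> f x2 <> D -> False.
Proof.
intros T Hy Hyv E1 E2 x1 x2 H1 H2 H12 N1 N2.
assert (Hev := gap6_even_apart T Hy Hyv E1 E2).
destruct (T) as [W F _]; assert (H := word_free W).
assert (Hroom := first_pair_room W F (y:=y) (m:=6) ltac:(lia) ltac:(lia) Hyv E2).
destruct F as [Hv Hv1 _ _].
destruct (f x1) eqn:F1, (f x2) eqn:F2; try congruence.
- assert (G1 : f (2 * x1 - y) <> D) by (intros E; rainbow H F1 E1 E).
  destruct H12 as [H12 | H12].
  + apply (Hev (2 * x1 - y) (2 * x2 - y)); auto; try lia; [exists (x1 - y); lia |].
    intros E; rainbow H F2 E1 E.
  + apply (Hev (2 * x1 - y) (2 * x2 - (y + 6))); auto; try lia; [exists (x1 - y); lia |].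
    intros E; rainbow H F2 E2 E.
- apply (XY_apart W (x:=x1) (y:=x2)); auto; lia.
- apply (XY_apart W (x:=x2) (y:=x1)); auto; lia.
- apply (@YY_far f n v v' x1 (x2 - x1) T); auto; try lia.
  now replace (x1 + (x2 - x1)) with x2 by lia.
Qed.

Definition colored (u : color) (f : Z -> color) (x : Z) : bool := color_eqb (f x) u.

Lemma coloredP u f x : colored u f x = true <-> f x = u.
Proof. apply color_eqbP. Qed.

Lemma not_coloredP u f x : negb (colored u f x) = true <-> f x <> u.
Proof.
rewrite <- coloredP; destruct (colored u f x); split; intros; try discriminate; auto.
Qed.

(** Of three consecutive places of the parity of [y] two are [D], and of three
    consecutive places of the other parity as well, in an interval that contains
    half of them. This makes up one half of all places, up to a constant. *)
Lemma gap6_dense {f v v' y} {n : nat} : two_sided f (Z.of_nat n) v v' ->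
  6 <= y -> y + 6 < v -> f y = Y -> f (y + 6) = Y ->
  8 * (Z.of_nat n - 10) <= 17 * cnt (colored D f) 0 n.
Proof.
intros T Hy Hyv E1 E2.
assert (Hev := gap6_even_apart T Hy Hyv E1 E2).
assert (Hod := gap6_odd_apart T Hy Hyv E1 E2).
destruct (T) as [W F _].
assert (Hroom := first_pair_room W F (y:=y) (m:=6) ltac:(lia) ltac:(lia) Hyv E2).
destruct F as [Hv Hv1 _ _]; clear T W.
assert (Ha : exists a c, 2 <= a <= 3 /\ y = a + 2 * c).
  destruct (Z.Even_or_Odd y) as [[c Hc] | [c Hc]]; [exists 2, (c - 1) | exists 3, (c - 1)];
    lia.
destruct Ha as (a & c & Ha & Hc).
set (l := Z.to_nat ((Z.of_nat n - 1 - a) / 2)).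
(* Among the letters of the other parity, number [i0 + i] with [i < l'] are
   those for which both reflections stay away from the borders. *)
set (i0 := (y + 9 - 2 * a) / 4).
set (l' := Z.to_nat ((Z.of_nat n - 5 + y - 2 * a) / 4 - i0 + 1)).
assert (Te : 3 * cnt (fun i => negb (colored D f (a + 2 * i))) 0 l <= Z.of_nat l + 3 - 1).
  apply cnt_spaced; [lia |].
  intros p q Hp Hpq Hq Hd Np Nq; apply not_coloredP in Np; apply not_coloredP in Nq.
  apply (Hev (a + 2 * p) (a + 2 * q)); auto; try (unfold l in *; dlia).
  exists (p - c); lia.
assert (To : 3 * cnt (fun i => negb (colored D f (a + 1 + 2 * i))) i0 l'
             <= Z.of_nat l' + 3 - 1).
  apply cnt_spaced; [lia |].
  intros p q Hp Hpq Hq Hd Np Nq; apply not_coloredP in Np; apply not_coloredP in Nq.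
  apply (Hod (a + 1 + 2 * p) (a + 1 + 2 * q)); auto; unfold i0, l' in *; dlia.
assert (Ne := cnt_negb (fun i => colored D f (a + 2 * i)) 0 l).
assert (No := cnt_negb (fun i => colored D f (a + 1 + 2 * i)) i0 l').
assert (Sub := cnt_sub (fun i => colored D f (a + 1 + 2 * i)) 0 i0 l l'
                 ltac:(unfold i0; dlia) ltac:(unfold i0, l, l'; dlia)).
assert (Tot := cnt_sub (colored D f) 0 a n (2 * l)%nat ltac:(lia) ltac:(unfold l; dlia)).
rewrite cnt_parity in Tot.
unfold l, l', i0 in *; dlia.
Qed.

(** * A gap of length fifteen *)

Definition unit15 (x : Z) : bool := negb (x mod 3 =? 0) && negb (x mod 5 =? 0).

Lemma unit15P x : unit15 x = true <-> x mod 3 <> 0 /\ x mod 5 <> 0.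
Proof.
unfold unit15; destruct (Z.eqb_spec (x mod 3) 0), (Z.eqb_spec (x mod 5) 0);
  cbn; split; intros; try discriminate; tauto.
Qed.

Lemma forced_15_check :
  all (fun j => unit15 (Z.of_nat j) ==> (j \in forced 15)) (iota 1 14).
Proof. by vm_compute. Qed.

Lemma forced_15 z : 0 < z < 15 -> unit15 z = true -> Z.to_nat z \in forced 15.
Proof.
intros Hz Hu.
assert (Hf := allP forced_15_check (Z.to_nat z)).
revert Hf; rewrite mem_iota; generalize (forced 15); intros s Hf.
assert (Hj := Hf ltac:(lia)).
replace (Z.of_nat (Z.to_nat z)) with z in Hj by lia.
now rewrite Hu in Hj.
Qed.

Lemma unit15_pairs :
  all (fun j => [|| unit15 (Z.of_nat j), unit15 (Z.of_nat j + 1), j == 5%N | j == 9%N])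
      (iota 1 13).
Proof. by vm_compute. Qed.

Lemma gap15_colors {f n y x} : word f n -> 0 <= y -> y + 15 < n -> gap f y 15 ->
  y < x -> x + 1 < y + 15 -> pair_at f X x ->
  (forall z, 0 < z < 15 -> unit15 z = true -> f (y + z) = D) /\
  (forall z, z = 3 \/ z = 6 \/ z = 9 \/ z = 12 -> f (y + z) = X).
Proof.
intros W Hy Hyn G Hx Hx1 [P1 P2]; assert (H := word_free W).
assert (HD : forall z, 0 < z < 15 -> unit15 z = true -> f (y + z) = D).
  intros z Hz Hu.
  assert (E := forced_D (m:=15) W Hy Hyn isT G (forced_15 Hz Hu)).
  now replace (y + Z.of_nat (Z.to_nat z)) with (y + z) in E by lia.
split; [exact HD |].
destruct G as [E1 E2 Hin].
assert (Hj : x = y + 5 \/ x = y + 9).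
  assert (N1 : unit15 (x - y) <> true).
    intros Hu; assert (E := HD (x - y) ltac:(lia) Hu).
    replace (y + (x - y)) with x in E by lia; congruence.
  assert (N2 : unit15 (x + 1 - y) <> true).
    intros Hu; assert (E := HD (x + 1 - y) ltac:(lia) Hu).
    replace (y + (x + 1 - y)) with (x + 1) in E by lia; congruence.
  assert (Hp := allP unit15_pairs (Z.to_nat (x - y))); cbn beta in Hp.
  rewrite mem_iota in Hp; specialize (Hp ltac:(lia)).
  replace (Z.of_nat (Z.to_nat (x - y))) with (x - y) in Hp by lia.
  replace (x - y + 1) with (x + 1 - y) in Hp by lia.
  case/or4P: Hp => Hp; [contradiction | contradiction | left | right]; lia.
assert (H12 : f (y + 12) = X).
  destruct Hj as [-> | ->].
  - third H E1 P2 (y + 12) as [E | E]; [| exact E].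
    destruct (Hin (y + 12)); auto; lia.
  - third H E2 P1 (y + 12) as [E | E]; [| exact E].
    destruct (Hin (y + 12)); auto; lia.
assert (H9 : f (y + 9) = X).
  third H E2 H12 (y + 9) as [E | E]; [| exact E].
  destruct (Hin (y + 9)); auto; lia.
assert (H6 : f (y + 6) = X).
  third H E1 H12 (y + 6) as [E | E]; [| exact E].
  destruct (Hin (y + 6)); auto; lia.
assert (H3 : f (y + 3) = X).
  third H E1 H6 (y + 3) as [E | E]; [| exact E].
  destruct (Hin (y + 3)); auto; lia.
intros z [-> | [-> | [-> | ->]]]; auto.
Qed.

(** By induction on the distance to the gap. An [X] would have its middle with one
    of the ends at a unit nearer to the gap, which is [D]. A [Y] would have such a
    middle with one of the letters [X] at the multiples of three. *)
Lemma gap15_units {f n y x} : word f n -> 0 <= y -> y + 15 < n -> gap f y 15 ->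
  y < x -> x + 1 < y + 15 -> pair_at f X x ->
  forall z, 0 <= y + z < n -> unit15 z = true -> f (y + z) = D.
Proof.
intros W Hy Hyn G Hx Hx1 P; assert (H := word_free W).
destruct (gap15_colors W Hy Hyn G Hx Hx1 P) as [HD HX].
destruct G as [E1 E2 _].
intros z; remember (Z.to_nat (Z.abs (2 * z - 15))) as l eqn:El; revert z El.
induction l as [l IH] using (well_founded_induction Wf_nat.lt_wf).
intros z -> Hz Hu; assert (Hu' := Hu); apply unit15P in Hu'.
destruct (classic (0 < z < 15)) as [Hin | Hin]; [now apply HD |].
assert (Hout : z <= -1 \/ 16 <= z).
  assert (z <> 0 /\ z <> 15) by (split; intros ->; destruct Hu'; auto); lia.
destruct (f (y + z)) eqn:Ez; auto; exfalso.
- assert (Hw : exists e w, (e = 0 \/ e = 15) /\ z + e = 2 * w).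
    destruct (Z.Even_or_Odd z) as [[h Hh] | [h Hh]]; [exists 0, h | exists 15, (h + 8)]; lia.
  destruct Hw as (e & w & He & Hw).
  assert (Ee : f (y + e) = Y).
    destruct He as [-> | ->]; auto; now replace (y + 0) with y by lia.
  assert (Ew : f (y + w) = D).
    apply (IH (Z.to_nat (Z.abs (2 * w - 15)))); auto; try lia.
    apply unit15P; clear - Hu' He Hw; dlia.
  rainbow H Ee Ew Ez.
- (* Two multiples of three that differ by six: one of the two middles is a unit. *)
  assert (Hw : exists e w, (e = 3 \/ e = 6 \/ e = 9 \/ e = 12) /\ z + e = 2 * w /\
                 unit15 w = true).
    destruct (Z.Even_or_Odd z) as [[h Hh] | [h Hh]].
    + destruct (Z.eq_dec ((h + 3) mod 5) 0).
        exists 12, (h + 6); rewrite unit15P; clear IH HD HX; dlia.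
      exists 6, (h + 3); rewrite unit15P; clear IH HD HX; dlia.
    + destruct (Z.eq_dec ((h + 2) mod 5) 0).
        exists 9, (h + 5); rewrite unit15P; clear IH HD HX; dlia.
      exists 3, (h + 2); rewrite unit15P; clear IH HD HX; dlia.
  destruct Hw as (e & w & He & Hw & Huw).
  assert (Ew : f (y + w) = D).
    apply (IH (Z.to_nat (Z.abs (2 * w - 15)))); auto; lia.
  rainbow H (HX e He) Ew Ez.
Qed.

Lemma unit15_period x : unit15 (x + 15) = unit15 x.
Proof.
apply Bool.eq_true_iff_eq; rewrite !unit15P; dlia.
Qed.

Lemma unit15_dense_base :
  all (fun s => all (fun l => 8 * (Z.of_nat l - 10) <=? 17 * cnt unit15 (Z.of_nat s) l)
                    (iota 0 15)) (iota 0 15).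
Proof. by vm_compute. Qed.

Lemma cnt_unit15_block : all (fun s => cnt unit15 (Z.of_nat s) 15 =? 8) (iota 0 15).
Proof. by vm_compute. Qed.

Lemma unit15_dense s l : 8 * (Z.of_nat l - 10) <= 17 * cnt unit15 s l.
Proof.
assert (Hmod : cnt unit15 s l = cnt unit15 (Z.of_nat (Z.to_nat (s mod 15))) l).
  apply cnt_ext; intros i _.
  assert (Hs := Z.div_mod s 15 ltac:(lia)).
  assert (Hr := Z.mod_pos_bound s 15 ltac:(lia)).
  replace (Z.of_nat (Z.to_nat (s mod 15))) with (s mod 15) by lia.
  generalize dependent (s mod 15); intros r Hs Hr.
  apply Bool.eq_true_iff_eq; rewrite !unit15P; clear Hr.
  generalize dependent (s / 15); intros q ->.
  replace (15 * q + r + i) with (r + i + (5 * q) * 3) by lia.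
  rewrite Z.mod_add; [| lia].
  replace (r + i + 5 * q * 3) with (r + i + (3 * q) * 5) by lia.
  rewrite Z.mod_add; [tauto | lia].
rewrite Hmod.
assert (Hs' : Z.to_nat (s mod 15) \in iota 0 15).
  rewrite mem_iota; assert (Hr := Z.mod_pos_bound s 15 ltac:(lia)); lia.
revert Hs'; generalize (Z.to_nat (s mod 15)); clear; intros s Hs.
induction l as [l IH] using (well_founded_induction Wf_nat.lt_wf).
destruct (Nat.lt_ge_cases l 15) as [Hl | Hl].
  assert (B := allP (allP unit15_dense_base s Hs) l); cbn beta in B.
  rewrite mem_iota in B; specialize (B ltac:(lia)).
  apply Z.leb_le; exact B.
replace l with (15 + (l - 15))%nat by lia.
rewrite cnt_cat.
assert (B := allP cnt_unit15_block s Hs); cbn beta in B; apply Z.eqb_eq in B.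
rewrite B.
assert (C := IH (l - 15)%nat ltac:(lia)).
rewrite (cnt_ext unit15 unit15 (Z.of_nat s + Z.of_nat 15) (Z.of_nat s)); [lia |].
intros i _; rewrite -(unit15_period (Z.of_nat s + i)); f_equal; lia.
Qed.

Lemma gap15_dense {f y x} {n : nat} : word f (Z.of_nat n) -> 0 <= y ->
  y + 15 < Z.of_nat n -> gap f y 15 ->
  y < x -> x + 1 < y + 15 -> pair_at f X x ->
  8 * (Z.of_nat n - 10) <= 17 * cnt (colored D f) 0 n.
Proof.
intros W Hy Hyn G Hx Hx1 P.
assert (Hu := gap15_units W Hy Hyn G Hx Hx1 P).
assert (H1 := @unit15_dense (0 - y) n).
assert (H2 : cnt unit15 (0 - y) n <= cnt (colored D f) 0 n).
  apply cnt_le; intros i Hi Hp; apply coloredP.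
  replace (0 + i) with (y + (0 - y + i)) by lia.
  apply Hu; [lia | exact Hp].
lia.
Qed.

(** * Counting the isolated letters *)

Lemma exists_first_pair {f n x} : 0 <= x -> x + 1 < n -> pair_at f X x ->
  exists v, first_pair f n v.
Proof.
remember (Z.to_nat x) as l eqn:El; revert x El.
induction l as [l IH] using (well_founded_induction Wf_nat.lt_wf).
intros x -> Hx Hx1 Px.
destruct (classic (exists z, 0 <= z < x /\ pair_at f X z)) as [(z & Hz & Pz) | Hn].
  apply (IH (Z.to_nat z) ltac:(lia) z); auto; lia.
exists x; split; auto; intros z Hz Pz; apply Hn; exists z; auto.
Qed.

Lemma exists_two_sided {f n x} : word f n -> 0 <= x -> x + 1 < n -> pair_at f X x ->
  exists v v', two_sided f n v v' /\ v + v' + 2 <= n.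
Proof.
intros W Hx Hx1 Px.
destruct (exists_first_pair Hx Hx1 Px) as [v F].
assert (F0 := F); destruct F0 as [Hv Hv1 [V1 V2] _].
assert (Pv : pair_at (flip n f) X (n - 2 - v)).
  split; unfold flip.
    now replace (n - 1 - (n - 2 - v)) with (v + 1) by lia.
  now replace (n - 1 - (n - 2 - v + 1)) with v by lia.
destruct (@exists_first_pair (flip n f) n (n - 2 - v) ltac:(lia) ltac:(lia) Pv) as [v' F'].
exists v, v'; split; [now split |].
destruct F' as [_ _ _ Hmin].
destruct (Z_lt_le_dec (n - 2 - v) v'); [| lia].
exfalso; apply (Hmin (n - 2 - v)); auto; lia.
Qed.

(** Length six cannot be excluded locally: if all letters other than [D] are at
    multiples of three, such gaps are possible. It is excluded because it makes
    [D] too frequent. *)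
Lemma Yfree_upto8 {f v v'} {n : nat} : two_sided f (Z.of_nat n) v v' ->
  17 * cnt (colored D f) 0 n < 8 * (Z.of_nat n - 10) ->
  forall d, 0 < d <= 8 -> Yfree f v 12 d.
Proof.
intros T Hn; destruct (T) as [W F _].
assert (F4 := Yfree_upto4 W F).
assert (F5 : Yfree f v 6 5).
  apply (Yfree_odd (b:=2) (m:=5) W F); auto; [lia |].
  intros d Hd; apply F4; lia.
assert (F6 : Yfree f v 6 6).
  intros y Hy Hyv E1 E2; assert (Hs := gap6_dense T Hy Hyv E1 E2); lia.
assert (F6' : forall d, 0 < d <= 6 -> Yfree f v 6 d).
  intros d Hd; destruct (Z.eq_dec d 6) as [-> | ?]; auto.
  destruct (Z.eq_dec d 5) as [-> | ?]; auto.
  apply (@Yfree_le f v 2); [lia | apply F4; lia].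
assert (F7 : Yfree f v 12 7).
  apply (Yfree_odd (b:=6) (m:=7) W F); auto; [lia |].
  intros d Hd; apply F6'; lia.
assert (F7' : forall d, 0 < d <= 7 -> Yfree f v 12 d).
  intros d Hd; destruct (Z.eq_dec d 7) as [-> | ?]; auto.
  apply (@Yfree_le f v 6); [lia | apply F6'; lia].
assert (F8 : Yfree f v 12 8).
  apply (Yfree_even (b:=12) (h:=4) W F); auto; [lia |].
  intros d Hd; apply F7'; lia.
intros d Hd; destruct (Z.eq_dec d 8) as [-> | ?]; auto; apply F7'; lia.
Qed.

(** The letters [Y] before the first pair lie in the first half of that part.
    There they are at distance at least three near the border and at least nine
    elsewhere, which is better than distance 17 in the whole part. *)
Lemma left_count {f v v'} {n : nat} : two_sided f (Z.of_nat n) v v' ->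
  17 * cnt (colored D f) 0 n < 8 * (Z.of_nat n - 10) ->
  17 * cnt (colored Y f) 0 (Z.to_nat v) <= v + 71.
Proof.
intros T Hn; assert (F8 := Yfree_upto8 T Hn); destruct T as [W F _].
assert (F0 := F); destruct F0 as [Hv Hv1 _ _].
assert (F1 : Yfree f v 0 1) by (apply (Yfree_1 W); lia).
assert (F2 := Yfree_2 W F).
assert (Hh : exists h, 2 * h - 2 <= v < 2 * h).
  destruct (Z.Even_or_Odd v) as [[h Hh] | [h Hh]]; exists (h + 1); lia.
destruct Hh as [h Hh].
assert (H3 : forall l, Z.of_nat l <= v ->
          3 * cnt (colored Y f) 0 l <= Z.of_nat l + 3 - 1).
  intros l Hl; apply cnt_spaced; [lia |].
  intros x y Hx Hxy Hy Hd Px Py; apply coloredP in Px; apply coloredP in Py.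
  destruct (Z.eq_dec y (x + 1)) as [-> | ?]; [apply (F1 x); auto; lia |].
  apply (F2 x); auto; try lia; now replace (x + 2) with y by lia.
destruct (Z_lt_le_dec v h) as [Hvh | Hvh].
  assert (C := H3 (Z.to_nat v) ltac:(lia)); lia.
assert (Hsplit : cnt (colored Y f) 0 (Z.to_nat v) = cnt (colored Y f) 0 (Z.to_nat h)).
  replace (Z.to_nat v) with (Z.to_nat h + Z.to_nat (v - h))%nat by lia.
  rewrite cnt_cat (cnt_none _ (0 + _)); [lia |].
  intros i Hi; apply Bool.not_true_iff_false; intros E; apply coloredP in E.
  assert (Hhalf := first_pair_half W F (y:=i) ltac:(lia) E); lia.
rewrite Hsplit.
destruct (Z_lt_le_dec 12 h) as [H12 | H12]; cycle 1.
  assert (C := H3 (Z.to_nat h) ltac:(lia)); lia.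
replace (Z.to_nat h) with (12 + Z.to_nat (h - 12))%nat by lia.
rewrite cnt_cat.
assert (C := H3 12%nat ltac:(lia)).
assert (C2 : 9 * cnt (colored Y f) (0 + Z.of_nat 12) (Z.to_nat (h - 12))
             <= Z.of_nat (Z.to_nat (h - 12)) + 9 - 1).
  apply cnt_spaced; [lia |].
  intros x y Hx Hxy Hy Hd Px Py; apply coloredP in Px; apply coloredP in Py.
  apply (F8 (y - x) ltac:(lia) x); auto; try lia.
  now replace (x + (y - x)) with y by lia.
lia.
Qed.

(** A gap between the first and the last pair contains a pair. *)
Lemma middle_count {f v v'} {n : nat} : two_sided f (Z.of_nat n) v v' ->
  17 * cnt (colored D f) 0 n < 8 * (Z.of_nat n - 10) ->
  forall l, v + Z.of_nat l + v' <= Z.of_nat n ->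
  17 * cnt (colored Y f) v l <= Z.of_nat l + 17 - 1.
Proof.
intros T Hn l Hl; apply cnt_spaced; [lia |].
assert (Hv : 0 <= v) by (destruct T as [_ [Hv _ _ _] _]; exact Hv).
assert (Hv' : 0 <= v') by (destruct T as [_ _ [Hv' _ _ _]]; exact Hv').
intros x y Hx Hxy Hy Hd Px Py; apply coloredP in Px; apply coloredP in Py.
remember (Z.to_nat (y - x)) as d eqn:Ed; revert x y Ed Hx Hxy Hy Hd Px Py.
induction d as [d IH] using (well_founded_induction Wf_nat.lt_wf).
intros x y -> Hx Hxy Hy Hd Ex Ey.
destruct (classic (exists z, x < z < y /\ f z = Y)) as [(z & Hz & Ez) | Hno].
  apply (IH (Z.to_nat (z - x)) ltac:(lia) x z); auto; lia.
assert (G : gap f x (y - x)).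
  split; auto; [now replace (x + (y - x)) with y by lia |].
  intros z Hz Ez; apply Hno; exists z; split; [lia | exact Ez].
destruct (gap_cases T G ltac:(lia) ltac:(lia) ltac:(lia)) as [? | ? | (p & Hp & Hp1 & Pp)];
  [lia | lia |].
destruct T as [W _ _].
destruct (@gap_with_pair f (Z.of_nat n) x (y - x) p W ltac:(lia) ltac:(lia) ltac:(lia)
            G Hp Hp1 Pp) as [? | E]; [lia |].
rewrite E in G, Hp1.
assert (C := @gap15_dense f x p n W ltac:(lia) ltac:(lia) G Hp Hp1 Pp); lia.
Qed.

Lemma cnt_colors f a l :
  cnt (colored D f) a l + cnt (colored X f) a l + cnt (colored Y f) a l = Z.of_nat l.
Proof.
revert a; induction l as [|l IH]; intros a; cbn -[Z.of_nat]; [reflexivity |].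
specialize (IH (a + 1)); unfold colored in *; destruct (f a); cbn [color_eqb]; lia.
Qed.

(** The letters [Y] before the first pair, those between the pairs, and those after
    the last pair are together too few to complement [D] and [X]. *)
Lemma no_balanced_word {f k x} {n : nat} : word f (Z.of_nat n) ->
  cnt (colored D f) 0 n <= k -> cnt (colored X f) 0 n <= k ->
  17 * k + 80 < 8 * Z.of_nat n ->
  0 <= x -> x + 1 < Z.of_nat n -> pair_at f X x -> False.
Proof.
intros W HD HX Hk Hx Hx1 Px.
assert (Hn : 17 * cnt (colored D f) 0 n < 8 * (Z.of_nat n - 10)) by lia.
destruct (exists_two_sided W Hx Hx1 Px) as (v & v' & T & Hvv).
assert (T' := two_sided_flip T).
assert (Hrev : forall u, cnt (colored u (flip (Z.of_nat n) f)) 0 n = cnt (colored u f) 0 n).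
  intros u; exact (cnt_rev (colored u f) n).
assert (CL := left_count T Hn).
assert (CR := left_count T' ltac:(rewrite Hrev; exact Hn)).
assert (Hv : 0 <= v) by (destruct T as [_ [? _ _ _] _]; auto).
assert (Hv' : 0 <= v') by (destruct T as [_ _ [? _ _ _]]; auto).
set (l := (n - Z.to_nat v - Z.to_nat v')%nat).
assert (CM := middle_count T Hn (l:=l) ltac:(unfold l; lia)).
assert (CT := cnt_colors f 0 n).
assert (ER : cnt (colored Y f) (v + Z.of_nat l) (Z.to_nat v') =
             cnt (colored Y (flip (Z.of_nat n) f)) 0 (Z.to_nat v')).
  rewrite <- cnt_rev; apply cnt_ext; intros i Hi; unfold colored, flip; do 2 f_equal.
  unfold l; lia.
assert (ES : cnt (colored Y f) 0 n =
  cnt (colored Y f) 0 (Z.to_nat v) + cnt (colored Y f) v l +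
  cnt (colored Y f) (v + Z.of_nat l) (Z.to_nat v')).
  replace n with (Z.to_nat v + (l + Z.to_nat v'))%nat at 1 by (unfold l; lia).
  rewrite !cnt_cat; replace (0 + Z.of_nat (Z.to_nat v)) with v by lia; lia.
unfold l in *; lia.
Qed.

(** * The upper bound *)

Definition merge_colors (P q : nat) (f : Z -> nat) (x : Z) : color :=
  if f x == P then D else if f x == q then X else Y.

Lemma merge_colors_D P q f x : merge_colors P q f x = D <-> f x = P.
Proof.
unfold merge_colors; case: eqP => [-> | H]; [tauto |].
case: eqP => _; split; intros E; try discriminate; contradiction.
Qed.

Lemma merge_colors_X P q f x : q <> P -> merge_colors P q f x = X <-> f x = q.
Proof.
intros Hq; unfold merge_colors; case: eqP => [-> | H].
  split; intros E; [discriminate | congruence].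
case: eqP => E'; split; intros E; try discriminate; auto; contradiction.
Qed.

Lemma merge_colors_free {P q f n} : rainbow_free f n -> rainbow_free (merge_colors P q f) n.
Proof.
intros H a b c Ha Hb Hc E (N1 & N2 & N3); apply (H a b c Ha Hb Hc E).
unfold merge_colors in *; repeat split; intros F; rewrite F in N1 N2 N3; auto.
Qed.

Lemma merge_colors_word {P q f n x} : rainbow_free f n ->
  (forall z, 0 <= z -> z + 1 < n -> f z <> f (z + 1) -> f z = P \/ f (z + 1) = P) ->
  0 <= x -> x + 1 < n -> f x = q -> f (x + 1) = q -> q <> P ->
  word (merge_colors P q f) n /\ pair_at (merge_colors P q f) X x.
Proof.
intros H HP Hx Hx1 E1 E2 Hq.
assert (Px : pair_at (merge_colors P q f) X x) by (split; now apply merge_colors_X).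
assert (W : dominated (merge_colors P q f) n).
  split; [now apply merge_colors_free |].
  intros z y Hz Hy Hzy Ez Ey; apply (merge_colors_X f z Hq) in Ez.
  assert (N1 : f y <> P) by (rewrite <- (merge_colors_D P q f y); congruence).
  assert (N2 : f y <> q) by (rewrite <- (merge_colors_X f y Hq); congruence).
  destruct Hzy as [<- | <-].
  - destruct (HP z ltac:(lia) ltac:(lia)); congruence.
  - destruct (HP y ltac:(lia) ltac:(lia)); congruence.
split; [| exact Px]; split; [exact W |].
assert (HYY : forall z, 0 <= z -> z + 1 < n -> pair_at (merge_colors P q f) Y z -> False).
  intros z Hz Hz1 Pz.
  destruct (Z.lt_trichotomy x z) as [Hlt | [-> | Hlt]].
  - apply (no_pairs_of_two_colors W (s:=x) (t:=z)); auto; lia.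
  - destruct Px, Pz; congruence.
  - apply (no_pairs_of_two_colors (dominated_swap W) (s:=z) (t:=x)); try lia.
      destruct Pz as [F1 F2]; split; now rewrite ?F1 ?F2.
    destruct Px as [F1 F2]; split; now rewrite ?F1 ?F2.
intros z y Hz Hy Hzy Ez Ey; destruct Hzy as [<- | <-].
- apply (HYY z); [lia | lia | now split].
- apply (HYY y); [lia | lia | now split].
Qed.

(** As the dominant color has less than half of the places, some two neighboring
    places avoid it, and their common color serves as [X]. *)
Lemma rainbow_unavoidable {f : Z -> nat} {n : nat} {k : Z} :
  (forall q, cnt (fun x => f x == q) 0 n <= k) -> 17 * k + 80 < 8 * Z.of_nat n ->
  ~ rainbow_free f (Z.of_nat n).
Proof.
intros Hk Hn H.
assert (Hk0 : 0 <= k).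
  assert (B := cnt_bounds (fun x => f x == 0%N) 0 n); assert (B' := Hk 0%N); lia.
destruct (dominant_color H Hk ltac:(lia)) as [P HP].
assert (Hx : exists x, 0 <= x /\ x + 1 < Z.of_nat n /\ f x <> P /\ f (x + 1) <> P).
  apply NNPP; intros Hno.
  assert (S : 2 * cnt (fun x => negb (f x == P)) 0 n <= Z.of_nat n + 2 - 1).
    apply cnt_spaced; [lia |].
    move=> x y Hx Hxy Hy Hd /eqP Nx /eqP Ny; apply Hno; exists x.
    replace (x + 1) with y by lia; repeat split; auto; lia.
  assert (C := cnt_negb (fun x => f x == P) 0 n); assert (B := Hk P); lia.
destruct Hx as (x & Hx & Hx1 & N1 & N2).
assert (E : f (x + 1) = f x).
  apply NNPP; intros E; destruct (HP x Hx Hx1); auto.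
destruct (merge_colors_word H HP Hx Hx1 erefl E N1) as [W Px].
apply (@no_balanced_word _ k x n W); auto.
- rewrite (cnt_ext _ (fun z => f z == P) 0 0); [apply Hk |].
  intros i _; apply Bool.eq_true_iff_eq; rewrite coloredP merge_colors_D.
  exact: rwP eqP.
- rewrite (cnt_ext _ (fun z => f z == f x) 0 0); [apply Hk |].
  intros i _; apply Bool.eq_true_iff_eq; rewrite coloredP merge_colors_X //.
  exact: rwP eqP.
Qed.

Lemma has_rainbow_AP3 {n a d : nat} {c : nat -> nat} : (0 < d)%N -> (0 < a)%N ->
  (a + 2 * d <= n)%N -> c a <> c (a + d)%N -> c (a + d)%N <> c (a + 2 * d)%N ->
  c a <> c (a + 2 * d)%N -> has_rainbow_AP 3 n c.
Proof.
move=> Hd Ha Hn /eqP N1 /eqP N2 /eqP N3; exists a, d; split=> //.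
  by move=> i Hi; apply/andP; split; [exact: ltn_addr | nia].
case=> [|[|[|//]]] [|[|[|//]]] _ _ //= _; rewrite ?mul0n ?mul1n ?addn0 //;
  by rewrite eq_sym.
Qed.

Lemma cnt_count (c : nat -> nat) q a l :
  cnt (fun z => c (Z.to_nat z).+1 == q) (Z.of_nat a) l =
  Z.of_nat (count (fun x => c x == q) (iota a.+1 l)).
Proof.
elim: l a => [//|l IH] a.
have -> : count (fun x => c x == q) (iota a.+1 l.+1) =
          ((c a.+1 == q) + count (fun x => c x == q) (iota a.+2 l))%N by [].
change (cnt (fun z => c (Z.to_nat z).+1 == q) (Z.of_nat a) l.+1)
  with ((if c (Z.to_nat (Z.of_nat a)).+1 == q then 1 else 0) +
        cnt (fun z => c (Z.to_nat z).+1 == q) (Z.of_nat a + 1) l).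
replace (Z.of_nat a + 1) with (Z.of_nat a.+1) by lia.
rewrite IH; replace (Z.to_nat (Z.of_nat a)) with a by lia.
case: (c a.+1 == q); lia.
Qed.

Lemma rainbow_AP3_above {k : nat} {n : nat} {c : nat -> nat} :
  (17 * k + 80 < 8 * n)%N -> sub_coloring k n c -> has_rainbow_AP 3 n c.
Proof.
intros Hn Hc; apply NNPP; intros Hno.
set (f := fun z => c (Z.to_nat z).+1).
apply (@rainbow_unavoidable f n (Z.of_nat k)); [| lia |].
  intros q; assert (Hq := Hc q); assert (E := cnt_count c q 0 n).
  change (Z.of_nat 0) with 0 in E; unfold f; rewrite E; lia.
assert (Hlt : forall a b c', 0 <= a < Z.of_nat n -> 0 <= b < Z.of_nat n ->
  0 <= c' < Z.of_nat n -> a + c' = 2 * b -> a < b ->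
  f a <> f b -> f b <> f c' -> f a <> f c' -> False).
  intros a b c' Ha Hb Hc' E Hab N1 N2 N3; apply Hno.
  unfold f in *.
  apply (@has_rainbow_AP3 n (Z.to_nat a).+1 (Z.to_nat (b - a)) c); try lia.
  - by replace ((Z.to_nat a).+1 + Z.to_nat (b - a))%N with (Z.to_nat b).+1 by lia.
  - replace ((Z.to_nat a).+1 + Z.to_nat (b - a))%N with (Z.to_nat b).+1 by lia.
    by replace ((Z.to_nat a).+1 + 2 * Z.to_nat (b - a))%N with (Z.to_nat c').+1 by lia.
  - by replace ((Z.to_nat a).+1 + 2 * Z.to_nat (b - a))%N with (Z.to_nat c').+1 by lia.
intros a b c' Ha Hb Hc' E (N1 & N2 & N3).
destruct (Z.lt_trichotomy a b) as [Hab | [-> | Hab]].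
- exact (Hlt a b c' Ha Hb Hc' E Hab N1 N2 N3).
- auto.
- apply (Hlt c' b a); auto; lia.
Qed.

(** * The lower bound *)

(** The Legendre symbol modulo 17, with values 0, 1 and 2 instead of 0, 1 and -1. *)
Definition legendre17 (x : nat) : nat :=
  let r := (x %% 17)%N in
  if r == 0%N then 0%N
  else if r \in [:: 1; 2; 4; 8; 9; 13; 15; 16]%N then 1%N else 2%N.

Lemma legendre17_mod x : legendre17 (x %% 17)%N = legendre17 x.
Proof. by rewrite /legendre17 modn_mod. Qed.

Lemma legendre17_check :
  all (fun a => all (fun d =>
    [|| legendre17 a == legendre17 (a + d)%N,
        legendre17 (a + d)%N == legendre17 (a + 2 * d)%N
      | legendre17 a == legendre17 (a + 2 * d)%N]) (iota 0 17)) (iota 0 17).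
Proof. by vm_compute. Qed.

Lemma legendre17_no_rainbow n : ~ has_rainbow_AP 3 n legendre17.
Proof.
case=> a [d [_ _ H]].
have red i : legendre17 (a + i * d) = legendre17 (a %% 17 + i * (d %% 17)).
  rewrite -[LHS]legendre17_mod -[RHS]legendre17_mod; congr legendre17.
  by rewrite modnDml -[RHS]modnDmr modnMmr modnDmr.
have Ha : (a %% 17)%N \in iota 0 17 by rewrite mem_iota ltn_pmod.
have Hd : (d %% 17)%N \in iota 0 17 by rewrite mem_iota ltn_pmod.
have /= := allP (allP legendre17_check _ Ha) _ Hd.
have := H 0%N 1%N erefl erefl erefl; have := H 1%N 2%N erefl erefl erefl.
have := H 0%N 2%N erefl erefl erefl.
by rewrite !red !mul0n !mul1n !addn0 => /negbTE -> /negbTE -> /negbTE ->.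
Qed.

(** Full periods have eight residues and eight nonresidues each. The rest of [k]
    modulo 8 allows for a few more places. *)
Definition legendre_length (k : nat) : nat :=
  (17 * (k %/ 8) + nth 0 [:: 0; 1; 1; 3; 5; 7; 9; 11] (k %% 8))%N.

Lemma count_period q (p : pred nat) t :
  (forall x, p (x + 17)%N = p x) ->
  count p (iota 1 (17 * q + t)) = (q * count p (iota 1 17) + count p (iota 1 t))%N.
Proof.
move=> Hp; elim: q => [|q IH]; first by rewrite muln0 mul0n.
rewrite mulnS -addnA iotaD count_cat mulSn -[RHS]addnA -IH; congr addn.
rewrite -[(1 + 17)%N]/(17 + 1)%N iotaDl count_map; apply: eq_count => x /=.
by rewrite addnC Hp.
Qed.

Lemma legendre17_residues : forall s, (s < 8)%N -> forall q, (q <= 2)%N ->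
  (count (fun x => legendre17 x == q)
     (iota 1 (nth 0 [:: 0; 1; 1; 3; 5; 7; 9; 11] s)) <= s)%N.
Proof.
by case=> [|[|[|[|[|[|[|[|//]]]]]]]] _ [|[|[|//]]] _; vm_compute.
Qed.

Lemma legendre17_sub_coloring k : sub_coloring k (legendre_length k) legendre17.
Proof.
move=> q; rewrite /legendre_length count_period; last first.
  by move=> x; rewrite -[in RHS]legendre17_mod -[in LHS]legendre17_mod modnDr.
have [Hq | Hq] := leqP q 2; last first.
  have Hlt x : (legendre17 x == q) = false.
    apply/negbTE; apply: contraTneq Hq => <-.
    by rewrite /legendre17; case: ifP => // _; case: ifP.
  by rewrite !(eq_count Hlt) !count_pred0 muln0.
have Hr := legendre17_residues (ltn_pmod k (isT : 0 < 8)%N) Hq.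
have H17 : (count (fun x => legendre17 x == q) (iota 1 17) <= 8)%N.
  by move: q Hq {Hr} => [|[|[|//]]] _; vm_compute.
by rewrite {3}(divn_eq k 8) leq_add // leq_mul.
Qed.

Lemma legendre_length_ge k : (17 * k <= 8 * legendre_length k + 32)%N.
Proof.
rewrite /legendre_length {1}(divn_eq k 8).
have : (k %% 8 < 8)%N by rewrite ltn_pmod.
by move: (k %% 8)%N (k %/ 8)%N => [|[|[|[|[|[|[|[|//]]]]]]]] q _ /=; lia.
Qed.

Lemma minimal_nat (P : nat -> Prop) U : P U ->
  exists s, [/\ P s, (s <= U)%N & forall m, P m -> (s <= m)%N].
Proof.
move: U; apply: (well_founded_induction Wf_nat.lt_wf) => U IH HU.
case: (classic (exists2 m, (m < U)%N & P m)) => [[m Hm HPm] | Hno].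
  have [s [H1 H2 H3]] := IH m ltac:(lia) HPm.
  by exists s; split=> //; apply: leq_trans H2 _; apply: ltnW.
exists U; split=> // m Hm; rewrite leqNgt; apply/negP => Hlt.
by apply: Hno; exists m.
Qed.

Local Close Scope Z_scope.
Local Open Scope ring_scope.

Theorem theorem5 (k : nat) (hk : (1 <= k)%N) :
  exists s : nat,
    is_sub_ramsey 3 k s /\
    (17%:R / 8%:R * k%:R - 4%:R <= s%:R :> rat) /\
    (s%:R <= 17%:R / 8%:R * k%:R + 10%:R :> rat).
Proof.
have HU : rainbow_AP_above 3 k ((17 * k + 80) %/ 8)%N.
  by move=> n Hn c; apply: rainbow_AP3_above; lia.
have [s [Hs HsU Hmin]] := minimal_nat HU.
exists s; split; first by split.
have lower : (17 * k <= 8 * s + 32)%N.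
  apply: leq_trans (legendre_length_ge k) _; rewrite leq_add2r leq_mul2l /=.
  rewrite leqNgt; apply/negP => Hlt.
  exact: legendre17_no_rainbow (Hs _ Hlt _ (legendre17_sub_coloring k)).
have upper : (8 * s <= 17 * k + 80)%N by lia.
have lowerQ : (17 * k)%N%:R <= (8 * s + 32)%N%:R :> rat by rewrite ler_nat.
have upperQ : (8 * s)%N%:R <= (17 * k + 80)%N%:R :> rat by rewrite ler_nat.
by split; lra.
Qed.
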